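(* Let $d'$ be a natural number, $c_{d'} := \frac{8}{3}(d'+1)^2 2^{4d'}$ and $d := c_{d'} \cdot 2^{4c_{d'}+4}$. There is an algorithm which, given an $n$-vertex graph $G$, a weight function $w : V(G) \to \mathbb Q$, and a $d'$-sequence of $G$, outputs an independent set $I$ of $G$ with $w(I) \geqslant \mathrm{OPT}/\lceil \frac{d+2}{3}\rceil$, where $w(I)=\sum_{v\in I} w(v)$ and $\mathrm{OPT}$ is the maximum weight of an independent set of $G$, in time $2^{O_d(\sqrt n)}$.
   Context: A trigraph consists of a vertex set together with two disjoint sets of unordered pairs of vertices: black edges and red edges. Contracting two (not necessarily adjacent) vertices $u,v$ of a trigraph into a new vertex $w$ produces the trigraph in which, for every other vertex $z$, $wz$ is a black edge if $uz$ and $vz$ were both black edges, $wz$ is a non-edge if $uz$ and $vz$ were both neither black nor red edges, and $wz$ is a red edge otherwise. A $d'$-sequence of an $n$-vertex graph $G$ is a sequence of trigraphs $G=G_n,\ldots,G_1$ where $G_1$ has one vertex, each $G_i$ is obtained from $G_{i+1}$ by one contraction, and in every $G_i$ every vertex is incident to at most $d'$ red edges. $O_d(\cdot)$ hides constants depending only on $d$. *)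

(* Defs.v *)
From HB Require Import structures.
From mathcomp Require Import all_boot all_order all_algebra.
From mathcomp Require Import finmap reals exp.

Set Implicit Arguments.
Unset Strict Implicit.
Unset Printing Implicit Defensive.

Import Order.TTheory GRing.Theory Num.Theory.
Local Open Scope fset_scope.

(** * Graphs and weighted independent sets *)

Record graph (n : nat) := Graph {
  edge : rel 'I_n;
  edge_sym : symmetric edge;
  edge_irr : irreflexive edge }.

Definition independent n (G : graph n) (I : {set 'I_n}) : bool :=
  [forall u in I, forall v in I, ~~ edge G u v].

Definition weight n (w : 'I_n -> rat) (I : {set 'I_n}) : rat :=
  (\sum_(v in I) w v)%R.

(* Weights may be negative. [set0] only serves to witness that some
   independent set exists. *)
Definition opt n (G : graph n) (w : 'I_n -> rat) : rat :=
  weight w [arg max_(I > set0 | independent G I) weight w I]%O.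

(** * Trigraphs and contraction sequences *)

Record trigraph := Trigraph {
  vset : {fset nat};
  black : rel nat;
  red : rel nat;
  black_sym : symmetric black;
  red_sym : symmetric red;
  black_irr : irreflexive black;
  red_irr : irreflexive red;
  black_vset : forall x y, black x y -> x \in vset;
  red_vset : forall x y, red x y -> x \in vset;
  black_red_disjoint : forall x y, ~~ (black x y && red x y) }.

Definition red_degree (T : trigraph) (x : nat) : nat :=
  #|` [fset z in vset T | red T x z]|.

Definition graph_rel n (G : graph n) : rel nat := fun x y =>
  if (insub x, insub y) is (Some u, Some v) then edge G u v else false.

Section OfGraph.
Variables (n : nat) (G : graph n).

Fact graph_rel_sym : symmetric (graph_rel G).
Proof.
rewrite /graph_rel => x y.
by case: (insub x) => [u|]; case: (insub y) => [v|] //; apply: edge_sym.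
Qed.

Fact graph_rel_irr : irreflexive (graph_rel G).
Proof. by rewrite /graph_rel => x; case: (insub x) => // u; apply: edge_irr. Qed.

Fact graph_rel_vset x y :
  graph_rel G x y -> x \in [fset z in iota 0 n].
Proof.
by rewrite /graph_rel !inE mem_iota /=; case: insubP => // u ->.
Qed.

Fact graph_rel_disjoint x y : ~~ (graph_rel G x y && false).
Proof. by rewrite andbF. Qed.

Definition trigraph_of_graph : trigraph :=
  @Trigraph [fset z in iota 0 n] (graph_rel G) (fun _ _ => false)
    graph_rel_sym (fun _ _ => erefl) graph_rel_irr (fun _ => erefl)
    graph_rel_vset (fun x y (h : false) => False_ind _ (notF h))
    graph_rel_disjoint.

End OfGraph.

(* The relation [r] restricted to [S], plus the pairs [wz] with [z] in [S] and
   [f z]. *)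
Definition add_vertex (S : {fset nat}) (w : nat) (f : pred nat) (r : rel nat)
    : rel nat := fun x y =>
  if x == w then [&& y != w, y \in S & f y]
  else if y == w then (x \in S) && f x
  else [&& x \in S, y \in S & r x y].

Section Contract.
Variables (T : trigraph) (u v w : nat).

Definition other_vertices : {fset nat} := vset T `\ u `\ v.

Definition contract_black : pred nat := fun z => black T u z && black T v z.

Definition contract_nonedge : pred nat := fun z =>
  ~~ (black T u z || red T u z) && ~~ (black T v z || red T v z).

Definition contract_red : pred nat := fun z =>
  ~~ contract_black z && ~~ contract_nonedge z.

Fact add_vertex_sym S f r : symmetric r -> symmetric (add_vertex S w f r).
Proof.
rewrite /add_vertex => rC x y; case: eqP => [->|_]; case: eqP => //= _.
by rewrite rC; do 2!case: (_ \in S).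
Qed.

Fact add_vertex_irr S f r : irreflexive r -> irreflexive (add_vertex S w f r).
Proof.
by rewrite /add_vertex => rI x; case: eqP => //= _; rewrite rI !andbF.
Qed.

Fact add_vertex_vset S f r x y : add_vertex S w f r x y -> x \in w |` S.
Proof.
rewrite /add_vertex !inE; case: eqP => //= _.
by case: eqP => _ => [/andP[]|/and3P[]].
Qed.

Fact contract_disjoint x y :
  ~~ (add_vertex other_vertices w contract_black (black T) x y &&
      add_vertex other_vertices w contract_red (red T) x y).
Proof.
rewrite /add_vertex /contract_red; case: eqP => _.
  by case: (contract_black y); rewrite ?andbF.
case: eqP => _; first by case: (contract_black x); rewrite ?andbF.
by apply: contra (black_red_disjoint T x y) => /andP[/and3P[_ _ ->] /and3P[]].
Qed.

Definition contract : trigraph :=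
  @Trigraph (w |` other_vertices)
    (add_vertex other_vertices w contract_black (black T))
    (add_vertex other_vertices w contract_red (red T))
    (add_vertex_sym _ _ (black_sym T)) (add_vertex_sym _ _ (red_sym T))
    (add_vertex_irr _ _ (black_irr T)) (add_vertex_irr _ _ (red_irr T))
    (@add_vertex_vset _ _ _) (@add_vertex_vset _ _ _)
    contract_disjoint.

End Contract.

(* The successive contractions of the pairs in [s], starting from [T], form a
   sequence of trigraphs of red degree at most [d'] that ends with a
   one-vertex trigraph. The vertices created are named w, w + 1, ... in
   order. *)
Fixpoint contraction_sequence (d' : nat) (T : trigraph) (w : nat)
    (s : seq (nat * nat)) : Prop :=
  (forall x, x \in vset T -> red_degree T x <= d') /\
  match s with
  | [::] => #|` vset T| = 1
  | (u, v) :: s' =>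
      [/\ u \in vset T, v \in vset T, u != v &
          contraction_sequence d' (contract T u v w) w.+1 s']
  end.

(* The vertices of [G] are 0, ..., n - 1, so n is the first fresh name. *)
Definition d_sequence (d' n : nat) (G : graph n) (s : seq (nat * nat)) : Prop :=
  contraction_sequence d' (trigraph_of_graph G) n s.

(** * Model of computation *)

(* Deterministic random access machine with structured control. The memory
   consists of two-dimensional arrays of unbounded naturals and of rationals;
   a scalar variable is an array of which one cell is used. Uniform cost: every
   memory access, arithmetic operation, comparison, connective and command
   costs one. There is no multiplication, so that t steps produce numbers with
   O(t) more bits than the input, and the cost is polynomially related to
   Turing machine time (in t and the size of the input). *)

Inductive nexpr :=
  | NConst of nat
  | NCell of nat & nexpr & nexpr
  | NAdd of nexpr & nexpr
  | NSub of nexpr & nexpr.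

Inductive qexpr :=
  | QConst of rat
  | QCell of nat & nexpr & nexpr
  | QAdd of qexpr & qexpr
  | QSub of qexpr & qexpr.

Inductive bexpr :=
  | BLe of nexpr & nexpr
  | BQLe of qexpr & qexpr
  | BNot of bexpr
  | BAnd of bexpr & bexpr.

Inductive program :=
  | Skip
  | NSet of nat & nexpr & nexpr & nexpr
  | QSet of nat & nexpr & nexpr & qexpr
  | Seq of program & program
  | If of bexpr & program & program
  | While of bexpr & program.

Record memory := Memory {
  ncell : nat -> nat -> nat -> nat;
  qcell : nat -> nat -> nat -> rat }.

Fixpoint neval (m : memory) (e : nexpr) : nat :=
  match e with
  | NConst k => k
  | NCell a i j => ncell m a (neval m i) (neval m j)
  | NAdd e1 e2 => neval m e1 + neval m e2
  | NSub e1 e2 => neval m e1 - neval m e2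
  end.

Fixpoint qeval (m : memory) (e : qexpr) : rat :=
  match e with
  | QConst q => q
  | QCell a i j => qcell m a (neval m i) (neval m j)
  | QAdd e1 e2 => (qeval m e1 + qeval m e2)%R
  | QSub e1 e2 => (qeval m e1 - qeval m e2)%R
  end.

Fixpoint beval (m : memory) (b : bexpr) : bool :=
  match b with
  | BLe e1 e2 => neval m e1 <= neval m e2
  | BQLe e1 e2 => (qeval m e1 <= qeval m e2)%R
  | BNot b1 => ~~ beval m b1
  | BAnd b1 b2 => beval m b1 && beval m b2
  end.

Fixpoint ncost (e : nexpr) : nat :=
  match e with
  | NConst _ => 1
  | NCell _ i j => (ncost i + ncost j).+1
  | NAdd e1 e2 | NSub e1 e2 => (ncost e1 + ncost e2).+1
  end.

Fixpoint qcost (e : qexpr) : nat :=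
  match e with
  | QConst _ => 1
  | QCell _ i j => (ncost i + ncost j).+1
  | QAdd e1 e2 | QSub e1 e2 => (qcost e1 + qcost e2).+1
  end.

Fixpoint bcost (b : bexpr) : nat :=
  match b with
  | BLe e1 e2 => (ncost e1 + ncost e2).+1
  | BQLe e1 e2 => (qcost e1 + qcost e2).+1
  | BNot b1 => (bcost b1).+1
  | BAnd b1 b2 => (bcost b1 + bcost b2).+1
  end.

Definition update (X : Type) (f : nat -> nat -> nat -> X) (a i j : nat) (x : X)
    : nat -> nat -> nat -> X := fun a' i' j' =>
  if [&& a' == a, i' == i & j' == j] then x else f a' i' j'.

(* [exec p m t m']: started in memory [m], the program [p] halts at cost [t]
   in memory [m']. *)
Inductive exec : program -> memory -> nat -> memory -> Prop :=
  | ExecSkip m : exec Skip m 1 m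
  | ExecNSet m a i j e :
      exec (NSet a i j e) m (ncost i + ncost j + ncost e).+1
        (Memory (update (ncell m) a (neval m i) (neval m j) (neval m e))
           (qcell m))
  | ExecQSet m a i j e :
      exec (QSet a i j e) m (ncost i + ncost j + qcost e).+1
        (Memory (ncell m)
           (update (qcell m) a (neval m i) (neval m j) (qeval m e)))
  | ExecSeq m m1 m2 p1 p2 t1 t2 :
      exec p1 m t1 m1 -> exec p2 m1 t2 m2 ->
      exec (Seq p1 p2) m (t1 + t2).+1 m2
  | ExecIf m m1 b p1 p2 t :
      exec (if beval m b then p1 else p2) m t m1 ->
      exec (If b p1 p2) m (bcost b + t).+1 m1
  | ExecWhileStop m b p :
      ~~ beval m b -> exec (While b p) m (bcost b).+1 m
  | ExecWhileStep m m1 m2 b p t1 t2 :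
      beval m b -> exec p m t1 m1 -> exec (While b p) m1 t2 m2 ->
      exec (While b p) m (bcost b + t1 + t2).+1 m2.

(* Natural arrays: 0 holds n, 1 the adjacency matrix, 2 the contracted pairs
   (one per row). Rational array 0 holds the weights. Every other cell is 0. *)
Definition input n (G : graph n) (w : 'I_n -> rat) (s : seq (nat * nat))
    : memory :=
  Memory
    (fun a i j => match a, j with
       | 0, 0 => if i == 0 then n else 0
       | 1, _ => graph_rel G i j
       | 2, 0 => (nth (0, 0) s i).1
       | 2, 1 => (nth (0, 0) s i).2
       | _, _ => 0
       end)
    (fun a i j => match a, j with
       | 0, 0 => if insub i is Some v then w v else 0%R
       | _, _ => 0%R
       end).

(* The output is read off as an indicator vector in natural array 3. *)
Definition output n (m : memory) : {set 'I_n} :=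
  [set v : 'I_n | ncell m 3 v 0 != 0].

(** * Constants *)

Local Open Scope ring_scope.

Definition c_ (R : realType) (d' : nat) : R :=
  8 / 3 * (d'%:R + 1) ^+ 2 * 2 ^+ (4 * d').

Definition d_ (R : realType) (d' : nat) : R :=
  c_ R d' * powR 2 (4 * c_ R d' + 4).

(* [Num.ceil] is integer-valued. *)
Definition approx_ratio (R : realType) (d' : nat) : R :=
  (Num.ceil ((d_ R d' + 2) / 3))%:~R.

(* Main.v *)
Require Import Defs.
From mathcomp Require Import all_boot all_order all_algebra.
From mathcomp Require Import finmap reals exp zify ring lra.
From mathcomp Require boolp.
Import Order.TTheory GRing.Theory Num.Theory.

Set Implicit Arguments.
Unset Strict Implicit.
Unset Printing Implicit Defensive.

(* Contract along the sequence, but remove from a part its remaining vertices,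
   as a block, as soon as there are s = ceil(sqrt n) of them. This gives at most
   s + 1 blocks of at most 2s vertices. When a block is removed, all parts but
   its at most d' red neighbours are homogeneous to it, so every later block,
   except for those that meet these red neighbours, consists of vertices that
   are complete or anticomplete to it. Thus the blocks can be coloured with
   d' + 1 colours such that, of two adjacent vertices in different blocks of
   the same colour, one is complete to the block of the other.

   Let I be the heaviest colour class of an optimum and S the set of blocks
   that I meets. No vertex of I is complete to another block in S, and the
   vertices in S with this property are adjacent only inside blocks. So a
   heaviest independent set of such vertices is found block by block, by
   brute force, and has weight at least OPT / (d' + 1). The set S is also
   found by brute force; both searches take time 2^O(s). *)

Local Open Scope nat_scope.

(** * Blocks *)

Lemma graph_relE n (G : graph n) (u v : 'I_n) : graph_rel G u v = edge G u v.
Proof. by rewrite /graph_rel !valK. Qed.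

Section Blocks.
Variables (n : nat) (G : graph n) (w : 'I_n -> rat) (l : 'I_n -> nat).

Definition block f : {set 'I_n} := [set v | l v == f].

Definition heaviest (A B : {set 'I_n}) :=
  [/\ B \subset A, independent G B &
      forall D : {set 'I_n}, D \subset A -> independent G D -> (weight w D <= weight w B)%R].

Lemma weight_set0 : weight w set0 = 0%R.
Proof. by rewrite /weight big_set0. Qed.

Lemma independent_set0 : independent G set0.
Proof. by apply/forallP => u; rewrite inE. Qed.

(** A vertex that is complete to another block in [S] can be discarded, since no independent set
    that meets every block of [S] contains it. *)
Definition allowed (S : nat -> bool) : {set 'I_n} :=
  [set v | S (l v) && [forall u, S (l u) && (l u != l v) ==>
     [exists u', (l u' == l u) && ~~ edge G v u']]].

Lemma eq_allowed S S' : (forall v, S (l v) = S' (l v)) -> allowed S = allowed S'.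
Proof.
move=> SS'; apply/setP=> v; rewrite !inE SS'; congr (_ && _).
by apply: eq_forallb => u; rewrite SS'.
Qed.

(** A relation and not a function, because ties make [C] ambiguous; the choices in different blocks
    do not influence each other. *)
Definition blockwise S (C : {set 'I_n}) :=
  forall v, heaviest (allowed S :&: block (l v)) (C :&: block (l v)).

End Blocks.

(** Greedy colouring from the largest label down: the constraints on a new label [f] come from the
    at most [d] labels in [M f], so one of [d + 1] colours is free. *)
Lemma degenerate_colouring d (M : nat -> seq nat) N :
  (forall f, size (M f) <= d) ->
  exists col : nat -> 'I_d.+1,
    forall f g, f < g < N -> g \in M f -> col f != col g.
Proof.
move=> size_M; suff H k : exists col : nat -> 'I_d.+1,
    forall f g, N <= f + k -> f < g < N -> g \in M f -> col f != col g.
  by have [col colP] := H N; exists col => f g; apply: colP; rewrite leq_addl.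
elim: k => [|k [col colP]]; first by exists (fun=> ord0) => f g; lia.
have [c cM] : exists c, c \notin [seq col g | g <- M (N - k.+1)].
  apply/existsP; rewrite -negb_forall; apply/negP => /forallP all_c.
  have := card_size [seq col g | g <- M (N - k.+1)].
  rewrite (eq_card (_ : _ =i 'I_d.+1)) ?card_ord; last by move=> c; rewrite inE all_c.
  by rewrite size_map ltnNge size_M.
exists (fun f => if f == N - k.+1 then c else col f) => f g Nf fgN gM.
rewrite [g == _]gtn_eqF; last by lia.
case: (eqVneq f _) => [fE|fN]; last by apply: (colP f g) => //; lia.
by apply: contra cM => /eqP->; apply: map_f; rewrite -fE.
Qed.

(** * Comparison of blockwise heaviest sets with the optimum *)

Section Optimum.
Variables (n : nat) (G : graph n) (w : 'I_n -> rat) (l : 'I_n -> nat).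

Lemma opt_attained : exists2 I, independent G I & opt G w = weight w I.
Proof.
rewrite /opt; case: Order.TotalTheory.arg_maxP => [|I iI _]; first exact: independent_set0.
by exists I.
Qed.

Lemma weight_blocks N (A : {set 'I_n}) : (forall v, l v < N) ->
  weight w A = (\sum_(f < N) weight w (A :&: block l f))%R.
Proof.
move=> lN; rewrite /weight (partition_big (fun v => Ordinal (lN v)) xpredT) //=.
by apply: eq_bigr => f _; apply: eq_bigl => v; rewrite !inE.
Qed.

Lemma sub_independent (A B : {set 'I_n}) :
  A \subset B -> independent G B -> independent G A.
Proof.
move=> /subsetP AB /forall_inP iB; apply/forall_inP => u /AB /iB /forall_inP H.
by apply/forall_inP => v /AB /H.
Qed.

Definition homogeneous v (K : {set 'I_n}) :=
  (forall u, u \in K -> edge G v u) \/ (forall u, u \in K -> ~~ edge G v u).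

Variables (d : nat) (M : nat -> seq nat).
Hypothesis size_M : forall f, size (M f) <= d.
Hypothesis M_homogeneous : forall f v,
  f < l v -> l v \notin M f -> homogeneous v (block l f).

(** [S] consists of the labels met by the heaviest colour class of an optimum. It is chosen before
    [C], so a search that tries every [S] needs neither the optimum nor the colouring. *)
Lemma blockwise_opt : exists S : nat -> bool,
  (forall x, S x -> [exists v, l v == x]) /\
  forall C, blockwise G w l S C ->
    independent G C /\ (opt G w <= d.+1%:R * weight w C)%R.
Proof.
have [N lN] : exists N, forall v, l v < N.
  by exists (\max_v l v).+1 => v; rewrite ltnS leq_bigmax.
have [col colP] := degenerate_colouring N size_M.
have [I iI optI] := opt_attained.
pose I_ c := [set v in I | col (l v) == c].
have [c cP] : exists c, forall c', (weight w (I_ c') <= weight w (I_ c))%R.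
  case: (Order.TotalTheory.arg_maxP (fun c => weight w (I_ c)) (isT : xpredT ord0)) => c _ H.
  by exists c => c'; apply: H.
pose S x := [exists v in I_ c, l v == x].
have Scol u : S (l u) -> col (l u) = c.
  by case/existsP=> v; rewrite inE => /andP[/andP[_ /eqP<-] /eqP->].
exists S; split=> [x|C bC].
  by case/existsP=> v /andP[_ lv]; apply/existsP; exists v.
have CA v : v \in C -> v \in allowed G l S.
  have [/subsetP H _ _] := bC v; have := H v.
  by rewrite !inE eqxx !andbT => K /K.
have CS v : v \in C -> S (l v) by move=> /CA; rewrite inE => /andP[].
(* If [l v] is not in [M (l u)], homogeneity leaves only the complete case to exclude, and [allowed]
   excludes it. Otherwise the two labels have different colours, whereas all labels in [S] have
   colour [c]. *)
have cross u v : u \in C -> v \in C -> l u < l v -> ~~ edge G v u.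
  move=> uC vC luv; case: (M_homogeneous luv) => [|full|]; last first.
  - by apply; rewrite inE.
  - move: (CA v vC); rewrite inE => /andP[_ /forallP/(_ u)].
    rewrite CS //= neq_ltn luv /= => /existsP[u' /andP[lu' /negP[]]].
    by apply: full; rewrite inE.
  - have luvN : l u < l v < N by rewrite luv lN.
    by apply/negP => /(colP _ _ luvN); rewrite !Scol ?CS ?eqxx.
split.
  apply/forall_inP => u uC; apply/forall_inP => v vC.
  case: (ltngtP (l u) (l v)) => luv.
  - by rewrite edge_sym cross.
  - by rewrite cross.
  - have [_ /forall_inP iB _] := bC v.
    have /iB/forall_inP : u \in C :&: block l (l v) by rewrite !inE uC luv eqxx.
    by apply; rewrite !inE vC eqxx.
apply: (@le_trans _ _ (\sum_(c' : 'I_d.+1) weight w (I_ c'))%R).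
  rewrite optI /weight (partition_big (fun v => col (l v)) xpredT) //= le_eqVlt.
  apply/orP; left; apply/eqP; apply: eq_bigr => c' _; apply: eq_bigl => v.
  by rewrite inE.
apply: (@le_trans _ _ (\sum_(c' : 'I_d.+1) weight w (I_ c))%R).
  by apply: ler_sum => c' _; apply: cP.
rewrite sumr_const card_ord mulr_natl lerMn2r /=.
rewrite (weight_blocks _ lN) (weight_blocks C lN); apply: ler_sum => f _.
(* [blockwise] speaks only of labels that occur; the other blocks are empty and have weight zero on
   both sides. *)
case: (pickP [pred v | l v == f]) => [v0 /= /eqP <-|f0]; last first.
  have -> : block l f = set0 by apply/setP=> v; rewrite !inE; apply: f0.
  by rewrite !setI0.
have [_ _] := bC v0; apply; last first.
  apply: sub_independent iI; apply/subsetP => v.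
  by rewrite !inE => /andP[/andP[]].
(* The class [I_ c] consists of allowed vertices: each block in [S] contains a vertex of it, which
   is not adjacent to [v] because [I] is independent. *)
apply: setSI; apply/subsetP => v vI; rewrite inE; apply/andP; split.
  by apply/existsP; exists v; rewrite vI eqxx.
apply/forallP => u; apply/implyP => /andP[/existsP[u' /andP[u'I lu']] _].
apply/existsP; exists u'; rewrite lu' /=.
move: vI u'I; rewrite !inE => /andP[vI _] /andP[u'I _].
by move/forall_inP: iI => /(_ v vI)/forall_inP/(_ u' u'I).
Qed.

End Optimum.

(** * Blocks from a contraction sequence *)

Lemma sum_eq_le1 a b y : \sum_(a <= x < b) (y == x) <= 1.
Proof.
rewrite (eq_bigr (fun x => if x == y then 1 else 0)) => [|x _]; last by rewrite eq_sym; case: eqP.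
by rewrite -big_mkcond sum1_count count_uniq_mem ?iota_uniq ?leq_b1.
Qed.

(** Each contraction removes two vertices and adds a fresh one, and a single vertex is left at the
    end. *)
Lemma card_contraction_sequence d T x cs :
  contraction_sequence d T x cs -> (forall y, y \in vset T -> y < x) ->
  #|` vset T| = (size cs).+1.
Proof.
elim: cs T x => [|[a b] cs IH] T x [_] //= [aT bT ab cs'] fresh.
have xO : x \notin other_vertices T a b.
  by apply/negP; rewrite !inE => /and3P[_ _ /fresh]; rewrite ltnn.
have /IH : forall y, y \in vset (contract T a b x) -> y < x.+1.
  move=> y; rewrite !inE => /orP[/eqP->//|/and3P[_ _ /fresh]]; lia.
move=> /(_ cs'); rewrite /= cardfsU1 xO => -[<-].
by rewrite (cardfsD1 a) aT (cardfsD1 b) !inE bT eq_sym ab.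
Qed.

Lemma size_d_sequence d n (G : graph n) cs : d_sequence d G cs -> n = (size cs).+1.
Proof.
move=> /card_contraction_sequence <-; last by move=> y; rewrite !inE mem_iota.
rewrite /= card_fseq undup_id ?iota_uniq ?size_iota //.
Qed.

Section Contraction.
Variables (n : nat) (G : graph n) (d s : nat).
Hypothesis s_gt0 : 0 < s.

(* The vertices in the part x of the current trigraph have label x + 2n, until
   the part that contains them gets at least [s] such vertices: these become a
   block, whose label x < 2n is final. *)
Definition merged (p : nat * nat) (l : 'I_n -> nat) : {set 'I_n} :=
  [set v | (l v == p.1 + (n + n)) || (l v == p.2 + (n + n))].

Definition merged_label p x l :=
  if s <= #|merged p l| then x else x + (n + n).

Definition relabel p x l v := if v \in merged p l then merged_label p x l else l v.

Fixpoint labels (cs : seq (nat * nat)) i : 'I_n -> nat :=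
  if i is j.+1 then relabel (nth (0, 0) cs j) (n + j) (labels cs j)
  else fun v => v + (n + n).

(** The invariant of the contraction, with [x] the next name. Final labels are below [2n] and grow
    with time, live ones are at least [2n]. Hence, for a block [f], the condition [f < l v] in
    [tracks_mixed] selects the vertices that were still live after [f] was removed. The list [M]
    there is kept up to date when its parts are merged. *)
Record tracks (T : trigraph) x (l : 'I_n -> nat) : Prop := Tracks {
  tracks_fresh y : y \in vset T -> y < x;
  tracks_name v : l v < x \/ exists2 y, y \in vset T & l v = y + (n + n);
  tracks_edge u v y z : l u = y + (n + n) -> l v = z + (n + n) -> y != z ->
    (black T y z -> edge G u v) /\
    (~~ black T y z -> ~~ red T y z -> ~~ edge G u v);
  tracks_mixed f : f < n + n -> exists2 M, size M <= d &
    forall v, f < l v -> l v \notin M -> homogeneous G v (block l f);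
  tracks_small f : #|block l f| <= s + (if f < n + n then s else 0);
  tracks_large v : l v < n + n -> s <= #|block l (l v)| }.

Lemma tracks_init : tracks (trigraph_of_graph G) n (fun v => v + (n + n)).
Proof.
split=> [y|v|u v y z|f fn|f|v].
- by rewrite !inE mem_iota.
- by right; exists (v : nat) => //; rewrite !inE mem_iota /= ltn_ord.
- move=> /addIn <- /addIn <- _; rewrite /= graph_relE; split=> // _.
(* No label is below [2n] yet, so block [f] is empty. *)
- by exists [::] => // v _ _; left=> u; rewrite inE gtn_eqF // ltn_addl.
- apply: leq_trans (_ : 1 <= _); last by rewrite ltn_addr.
  apply/card_le1P => u; rewrite inE => /eqP uf v.
  by rewrite !inE -uf eqn_add2r.
- by rewrite ltnNge leq_addl.
Qed.

Section Step.
Variables (T : trigraph) (x : nat) (l : 'I_n -> nat) (a b : nat).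
Hypotheses (Tl : tracks T x l) (aT : a \in vset T) (bT : b \in vset T).
Hypotheses (ab : a != b) (xn : x < n + n).

Let H := merged (a, b) l.
Let t := merged_label (a, b) x l.
Let l' := relabel (a, b) x l.
Let T' := contract T a b x.

(** The label [t] is fresh: old labels are below [x] or of the form [y + 2n] with [y < x], while [t]
    is [x] or [x + 2n] and [x < 2n]. *)
Let labelN v : l v != t.
Proof.
rewrite /t /merged_label; case: (tracks_name Tl v) => [lv|[y yT ->]];
  [|have := tracks_fresh Tl yT => yx]; case: ifP => _; apply/eqP; lia.
Qed.

Let mergedE v : v \in H -> l v = a + (n + n) \/ l v = b + (n + n).
Proof. by rewrite inE => /orP[] /eqP; [left|right]. Qed.

Let l'H v : v \in H -> l' v = t.
Proof. by rewrite /l' /relabel -/H => ->. Qed.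

Let l'N v : v \notin H -> l' v = l v.
Proof. by rewrite /l' /relabel -/H => /negbTE->. Qed.

Let blockt : block l' t = H.
Proof.
apply/setP=> v; rewrite inE; case: (boolP (v \in H)) => vH.
  by rewrite l'H ?eqxx.
by rewrite l'N // (negbTE (labelN v)).
Qed.

Let blockN f : f != t -> block l' f = block l f :\: H.
Proof.
move=> ft; apply/setP=> v; rewrite !inE -/H; case: (boolP (v \in H)) => vH.
  by rewrite l'H // eq_sym (negbTE ft); move: vH; rewrite inE => ->.
by rewrite l'N //; move: vH; rewrite inE => ->.
Qed.

Let otherP v y : v \notin H -> l v = y + (n + n) ->
  [/\ y \in other_vertices T a b, y != x, y != a & y != b].
Proof.
move=> vH lv; move: vH; rewrite inE lv !eqn_add2r negb_or => /andP[ya yb].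
case: (tracks_name Tl v) => [|[y' yT]]; rewrite lv; first by lia.
move=> /addIn yy'; rewrite -yy' in yT; split=> //.
  by rewrite !inE yb ya.
by rewrite ltn_eqF // (tracks_fresh Tl yT).
Qed.

Let merged_edge u v z : u \in H -> l v = z + (n + n) -> z != a -> z != b ->
  (contract_black T a b z -> edge G u v) /\ (contract_nonedge T a b z -> ~~ edge G u v).
Proof.
move=> uH lv za zb; rewrite /contract_nonedge !negb_or.
case: (mergedE uH) => lu; have [] := tracks_edge Tl lu lv; rewrite 1?eq_sym //;
  move=> B N; split.
- by case/andP=> /B.
- by case/andP=> /andP[B' R'] _; apply: N.
- by case/andP=> _ /B.
- by case/andP=> _ /andP[B' R']; apply: N.
Qed.

Let merged_edge' u v z : u \in H -> v \notin H -> l v = z + (n + n) ->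
  (black T' x z -> edge G u v) /\ (~~ black T' x z -> ~~ red T' x z -> ~~ edge G u v).
Proof.
move=> uH vH lv; have [zO zx za zb] := otherP vH lv.
have [B N] := merged_edge uH lv za zb.
rewrite /= /add_vertex eqxx zx zO /=; split=> // nB; rewrite /contract_red nB /=.
by rewrite negbK.
Qed.

(** Only the red degree of the new vertex matters: if its part becomes a block, its red neighbours
    are the exceptions for that block, and for older blocks the exceptions are merely renamed. *)
Lemma tracks_step : red_degree T' x <= d -> tracks T' x.+1 l'.
Proof.
move=> degx; split=> [y|v|u v y z|f fn|f|v].
- rewrite !inE => /orP[/eqP->//|/and3P[_ _ yT]].
  by rewrite ltnW // ltnS (tracks_fresh Tl).
- case: (boolP (v \in H)) => vH.
    rewrite l'H // /t /merged_label; case: ifP => _; [by left|right].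
    by exists x => //; rewrite !inE eqxx.
  rewrite l'N //; case: (tracks_name Tl v) => [lv|[y yT lv]]; first by left; lia.
  by right; exists y => //; have [yO _ _ _] := otherP vH lv; rewrite inE yO orbT.
- have live v' y' : v' \in H -> l' v' = y' + (n + n) -> y' = x.
    move=> v'H; rewrite l'H // /t /merged_label; case: ifP => _ e; first by lia.
    by apply/esym/(@addIn (n + n)).
  case: (boolP (u \in H)) => uH; case: (boolP (v \in H)) => vH.
  + by move=> /(live _ _ uH)-> /(live _ _ vH)->; rewrite eqxx.
  + by move=> /(live _ _ uH)->; rewrite l'N // => lv _; apply: merged_edge'.
  + rewrite l'N // => lu /(live _ _ vH)-> _.
    rewrite [black T' _ _]black_sym [red T' _ _]red_sym edge_sym.
    exact: merged_edge'.
  rewrite !l'N // => lu lv yz; have [B N] := tracks_edge Tl lu lv yz.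
  have [yO yx _ _] := otherP uH lu; have [zO zx _ _] := otherP vH lv.
  by rewrite /= /add_vertex (negbTE yx) (negbTE zx) yO zO.
- case: (eqVneq f t) => [ft|ft].
    have fx : f = x by move: fn; rewrite ft /t /merged_label; case: ifP => //; lia.
    exists [seq z + (n + n) | z <- enum_fset [fset z in vset T' | red T' x z]%fset].
      by rewrite size_map.
    move=> v; rewrite ft blockt => tv vM.
    have vH : v \notin H by apply/negP => vH; move: tv; rewrite l'H // ltnn.
    rewrite l'N // in tv vM *; case: (tracks_name Tl v) => [|[z zT lv]]; first by lia.
    have [zO zx za zb] := otherP vH lv.
    have nR : ~~ red T' x z.
      apply: contra vM => R; rewrite lv; apply/mapP; exists z => //.
      have zT' : z \in vset T' by rewrite in_fsetU zO orbT.
      rewrite -/(z \in [fset z in vset T' | red T' x z]%fset).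
      by apply/imfsetP; exists z => //=; apply/andP; split.
    case: (boolP (black T' x z)) => BT; [left|right] => u uH; rewrite edge_sym;
      have [B N] := merged_edge' uH vH lv; [exact: B|exact: N].
  have [M sM MP] := tracks_mixed Tl fn.
  (* [phi] gives both merged parts their common new label, so the list of exceptions of an older
     block does not get longer. *)
  pose phi g := if (g == a + (n + n)) || (g == b + (n + n)) then t else g.
  exists [seq phi g | g <- M]; first by rewrite size_map.
  move=> v fv vM; have -> : block l' f = block l f.
    rewrite blockN //; apply/setP=> u; rewrite !inE.
    case: (eqVneq (l u) f) => [->|_]; rewrite ?andbF //= andbT.
    by rewrite !ltn_eqF // ltn_addl.
  have l'phi : l' v = phi (l v) by rewrite /l' /relabel inE /phi.
  apply: MP; last by apply: contra vM => lvM; rewrite l'phi map_f.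
  case: (boolP (v \in H)) => vH; last by rewrite -l'N.
  by case: (mergedE vH) => ->; rewrite ltn_addl.
- case: (eqVneq f t) => [->|ft]; last first.
    by rewrite blockN // (leq_trans _ (tracks_small Tl f)) // subset_leq_card // subsetDl.
  rewrite blockt /t /merged_label -/H; case: (leqP s #|H|) => [_|Hs];
    last by rewrite (leq_trans (ltnW Hs)) ?leq_addr.
  rewrite xn.
  (* Both parts were live before the merge, hence have at most [s] vertices each. *)
  have -> : H = block l (a + (n + n)) :|: block l (b + (n + n)).
    by apply/setP=> v; rewrite !inE.
  have := tracks_small Tl (a + (n + n)); have := tracks_small Tl (b + (n + n)).
  rewrite !ltnNge !leq_addl /= !addn0 => bs as_.
  by apply: leq_trans (leq_add as_ bs); rewrite (leq_card_setU _ _).1.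
- case: (boolP (v \in H)) => vH.
    rewrite l'H // blockt /t /merged_label -/H; case: ifP => //; lia.
  rewrite l'N // blockN // => lv; rewrite (leq_trans (tracks_large Tl lv)) //.
  apply/subset_leq_card/subsetP => u; rewrite !inE => /eqP lu; rewrite lu eqxx andbT.
  by rewrite !ltn_eqF // ltn_addl.
Qed.

End Step.

Lemma tracks_labels cs : d_sequence d G cs -> forall i, i <= size cs ->
  exists T, tracks T (n + i) (labels cs i) /\
            contraction_sequence d T (n + i) (drop i cs).
Proof.
move=> dcs; have nE := size_d_sequence dcs; elim=> [|i IH] ics.
  by exists (trigraph_of_graph G); rewrite addn0 drop0; split=> //; apply: tracks_init.
have [T [Tl]] := IH (ltnW ics); rewrite (drop_nth (0, 0)) //=.
case: (nth _ _ _) => a b [_ [aT bT ab]] cs'.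
exists (contract T a b (n + i)); rewrite addnS; split=> //.
apply: tracks_step => //; first by lia.
by case: (drop _ _) cs' => [|? ?] /= [+ _]; apply; rewrite !inE eqxx.
Qed.

(** The vertices that are live at the end lie in the only part left and form one last block. Every
    other block has at least [s] of the at most [s * s] vertices, so there are at most [s] of
    those. *)
Lemma tracks_final cs : d_sequence d G cs -> n <= s * s ->
  let l := labels cs (size cs) in
  [/\ forall f, exists2 M, size M <= d &
        forall v, f < l v -> l v \notin M -> homogeneous G v (block l f),
      forall f, #|block l f| <= s + s,
      forall v, l v < n + n + (n + n) &
      \sum_(0 <= x < n + n + (n + n)) [exists v, l v == x] <= s.+1].
Proof.
move=> dcs ns l; have [T [Tl]] := tracks_labels dcs (leqnn _).
have nE := size_d_sequence dcs; rewrite drop_size => -[_ T1].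
have [r rE] : exists r, vset T = [fset r]%fset by apply/cardfs1P/eqP.
have lP v : l v < n + n \/ l v = r + (n + n).
  case: (tracks_name Tl v) => [lv|[y]]; first by left; rewrite -/l in lv; lia.
  by rewrite rE inE => /eqP->; right.
have rn : r < n + n by have := tracks_fresh Tl (y := r); rewrite rE inE eqxx; lia.
split.
- move=> f; case: (ltnP f (n + n)) => [/(tracks_mixed Tl)//|nf].
  (* A label above [f] can only be that of the last part. Then no vertex has label [f], and
     homogeneity is vacuous. *)
  exists [::] => // v; case: (lP v) => lv; first by lia.
  move=> fv _; right=> u; rewrite inE => /eqP uf.
  by case: (lP u); rewrite uf; lia.
- move=> f; apply: leq_trans (tracks_small Tl f) _; case: ifP; lia.
- by move=> v; case: (lP v) => lv; lia.
have card_blocks : \sum_(0 <= x < n + n) #|block l x| <= n.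
  under eq_bigr => x _ do rewrite -sum1_card big_mkcond /=.
  rewrite exchange_big /= -[leqRHS]card_ord -sum1_card; apply: leq_sum => v _.
  apply: leq_trans (sum_eq_le1 0 (n + n) (l v)); apply: eq_leq.
  by apply: eq_bigr => x _; rewrite inE; case: eqP.
rewrite (big_cat_nat (n := n + n)) ?leq_addr //= -addn1; apply: leq_add.
  rewrite -(leq_pmul2r s_gt0) (leq_trans _ ns) // (leq_trans _ card_blocks) //.
  rewrite big_distrl /= !big_mkord; apply: leq_sum => x _.
  case: existsP => [[v /eqP lv]|_] //; rewrite mul1n -lv.
  by apply: (tracks_large Tl); rewrite -/l lv.
apply: leq_trans (sum_eq_le1 (n + n) (n + n + (n + n)) (r + (n + n))).
rewrite big_nat [leqRHS]big_nat; apply: leq_sum => x /andP[nx _].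
case: existsP => // -[v /eqP vx].
by case: (lP v) => lv; [lia|rewrite -vx lv eqxx].
Qed.

End Contraction.

(** * Cost and memory of programs *)

(** The arrays that a program may assign are computed from its syntax, so that side conditions such
    as [a \notin nmods p] are settled by evaluation for concrete programs. *)
Fixpoint nmods (p : program) : seq nat :=
  match p with
  | NSet a _ _ _ => [:: a]
  | Seq p q | If _ p q => nmods p ++ nmods q
  | While _ p => nmods p
  | _ => [::]
  end.

Fixpoint qmods (p : program) : seq nat :=
  match p with
  | QSet a _ _ _ => [:: a]
  | Seq p q | If _ p q => qmods p ++ qmods q
  | While _ p => qmods p
  | _ => [::]
  end.

Fixpoint nreads (e : nexpr) : seq nat :=
  match e with
  | NConst _ => [::]
  | NCell a i j => a :: nreads i ++ nreads j
  | NAdd e1 e2 | NSub e1 e2 => nreads e1 ++ nreads e2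
  end.

Definition agree (X Y : seq nat) (m m' : memory) : Prop :=
  (forall a i j, a \notin X -> ncell m' a i j = ncell m a i j) /\
  (forall a i j, a \notin Y -> qcell m' a i j = qcell m a i j).

Notation frame p := (agree (nmods p) (qmods p)).

Lemma agree_trans X Y m1 m2 m3 :
  agree X Y m1 m2 -> agree X Y m2 m3 -> agree X Y m1 m3.
Proof.
move=> [n12 q12] [n23 q23].
by split=> a i j aX; [rewrite n23 ?n12|rewrite q23 ?q12].
Qed.

Lemma agreeW X Y X' Y' m m' :
  {subset X <= X'} -> {subset Y <= Y'} -> agree X Y m m' -> agree X' Y' m m'.
Proof.
move=> sX sY [nm qm]; split=> a i j aX.
  by apply: nm; apply: contra aX; apply: sX.
by apply: qm; apply: contra aX; apply: sY.
Qed.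

Lemma agree_cat X Y X' Y' m1 m2 m3 :
  agree X Y m1 m2 -> agree X' Y' m2 m3 -> agree (X ++ X') (Y ++ Y') m1 m3.
Proof.
by move=> h12 h23; apply: agree_trans (agreeW _ _ h12) (agreeW _ _ h23) => a;
  rewrite mem_cat => ->; rewrite ?orbT.
Qed.

Lemma neval_agree X Y m m' e :
  agree X Y m m' -> all (fun a => a \notin X) (nreads e) ->
  neval m' e = neval m e.
Proof.
move=> [nm _]; elim: e => //= [a i IHi j IHj|e1 IH1 e2 IH2|e1 IH1 e2 IH2].
- by case/andP=> aX; rewrite all_cat => /andP[/IHi-> /IHj->]; apply: nm.
- by rewrite all_cat => /andP[/IH1-> /IH2->].
- by rewrite all_cat => /andP[/IH1-> /IH2->].
Qed.

Lemma exec_frame p m t m' : exec p m t m' -> frame p m m'.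
Proof.
elim=> {p m t m'} //=.
- by move=> m a i j e; split=> // b k l; rewrite inE /= /update => /negbTE->.
- by move=> m a i j e; split=> // b k l; rewrite inE /= /update => /negbTE->.
- move=> m m1 m2 p1 p2 t1 t2 _ IH1 _ IH2.
  by apply: agree_trans (agreeW _ _ IH1) (agreeW _ _ IH2) => a; rewrite mem_cat => ->;
     rewrite ?orbT.
- move=> m m1 b p1 p2 t _; case: ifP => _; apply: agreeW => a;
    by rewrite mem_cat => ->; rewrite ?orbT.
- move=> m m1 m2 b p t1 t2 _ _ IH1 _ IH2; exact: agree_trans IH1 IH2.
Qed.

(* If every loop of [p] makes at most Z > 1 iterations, then [p] halts at cost
   at most Z ^ kcost p: kcost is an exponent, which depends on [p] only. *)
Fixpoint kcost (p : program) : nat :=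
  match p with
  | Skip => 1
  | NSet _ i j e => (ncost i + ncost j + ncost e).+1
  | QSet _ i j e => (ncost i + ncost j + qcost e).+1
  | Seq p q => kcost p + kcost q + 2
  | If b p q => bcost b + kcost p + kcost q + 2
  | While b p => bcost b + kcost p + 3
  end.

(** Total correctness and cost in one judgement. As the exponent depends on the syntax alone, the
    proofs below only have to bound numbers of iterations by [Z]. *)
Definition run (Z : nat) (p : program) (m : memory) (Q : memory -> Prop) :=
  exists t m', [/\ exec p m t m', t <= Z ^ kcost p & Q m'].

Section Run.
Variable Z : nat.
Hypothesis Z_gt1 : 1 < Z.

Let Z_gt0 : 0 < Z := ltnW Z_gt1.

Lemma leq_expZ k : k < Z ^ k.
Proof. exact: ltn_expl. Qed.

Lemma run_conseq p m (Q Q' : memory -> Prop) :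
  run Z p m Q -> (forall m', frame p m m' -> Q m' -> Q' m') -> run Z p m Q'.
Proof.
move=> [t [m' [e tZ Qm']]] QQ'; exists t, m'; split=> //.
by apply: QQ' Qm'; apply: exec_frame e.
Qed.

Lemma run_skip m (Q : memory -> Prop) : Q m -> run Z Skip m Q.
Proof. by move=> Qm; exists 1, m; split=> //; apply: ExecSkip. Qed.

Lemma run_nset a i j e m (Q : memory -> Prop) :
  Q (Memory (update (ncell m) a (neval m i) (neval m j) (neval m e)) (qcell m)) ->
  run Z (NSet a i j e) m Q.
Proof.
by move=> Qm; do 2!eexists; split; [apply: ExecNSet|apply/ltnW/leq_expZ|].
Qed.

Lemma run_qset a i j e m (Q : memory -> Prop) :
  Q (Memory (ncell m) (update (qcell m) a (neval m i) (neval m j) (qeval m e))) ->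
  run Z (QSet a i j e) m Q.
Proof.
by move=> Qm; do 2!eexists; split; [apply: ExecQSet|apply/ltnW/leq_expZ|].
Qed.

(** Each summand is at most [Z ^ (a + b + c)], and [3 <= 4 <= Z ^ 2]; this is the origin of the
    [+ 2] in [kcost]. *)
Lemma leq_add3_exp x y z a b c :
  x <= Z ^ a -> y <= Z ^ b -> z <= Z ^ c -> x + y + z <= Z ^ (a + b + c + 2).
Proof.
move=> xa yb zc; apply: (@leq_trans (4 * Z ^ (a + b + c))).
  have le k : k <= a + b + c -> Z ^ k <= Z ^ (a + b + c).
    by move=> ?; rewrite leq_pexp2l.
  have := leq_trans xa (le _ (leq_trans (leq_addr b a) (leq_addr c _))).
  have := leq_trans yb (le _ (leq_trans (leq_addl a b) (leq_addr c _))).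
  have := leq_trans zc (le _ (leq_addl _ _)).
  by lia.
rewrite [Z ^ (_ + 2)]expnD [4 * _]mulnC leq_mul2l; apply/orP; right.
by rewrite (@leq_exp2r 2 Z 2).
Qed.

Lemma run_seq p q m (Q : memory -> Prop) :
  run Z p m (fun m' => run Z q m' Q) -> run Z (Seq p q) m Q.
Proof.
move=> [t1 [m1 [e1 t1Z [t2 [m2 [e2 t2Z Qm2]]]]]].
exists (t1 + t2).+1, m2; split=> //; first exact: ExecSeq e1 e2.
rewrite -addn1 /= -[kcost p + kcost q]addn0.
exact: leq_add3_exp.
Qed.

Lemma run_if b p q m (Q : memory -> Prop) :
  run Z (if beval m b then p else q) m Q -> run Z (If b p q) m Q.
Proof.
move=> [t [m' [e tZ Qm']]]; exists (bcost b + t).+1, m'; split=> //.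
  exact: ExecIf e.
rewrite -addn1 /= (_ : bcost b + _ + _ + 2 = bcost b + (kcost p + kcost q) + 0 + 2);
  last by lia.
apply: leq_add3_exp => //; first exact/ltnW/leq_expZ.
apply: leq_trans tZ _; rewrite leq_pexp2l //.
by case: (beval m b); rewrite ?leq_addr ?leq_addl.
Qed.

Lemma run_while b p m (I : nat -> memory -> Prop) N :
  N <= Z -> I 0 m ->
  (forall k m', I k m' -> beval m' b -> k < N /\ run Z p m' (I k.+1)) ->
  run Z (While b p) m (fun m' => exists k, ~~ beval m' b /\ I k m').
Proof.
move=> NZ I0 step.
(* Induction on a bound [j] for the iterations left. For [j = N <= Z] the cost becomes a sum of
   three powers of [Z]. *)
suff loop j k m1 : N <= k + j -> I k m1 -> exists t m', [/\ exec (While b p) m1 t m',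
    t <= (bcost b).+1 + j * ((bcost b).+1 + Z ^ kcost p) &
    exists k, ~~ beval m' b /\ I k m'].
  have [t [m' [e tB Q]]] := loop N 0 m (leqnn _) I0.
  exists t, m'; split=> //; apply: leq_trans tB _.
  apply: (@leq_trans (Z ^ bcost b + Z ^ (bcost b).+1 + Z ^ (kcost p).+1)).
    rewrite mulnDr addnA !expnS; apply: leq_add; last by rewrite leq_mul2r NZ orbT.
    by apply: leq_add; rewrite ?leq_mul ?leq_expZ.
  have le k' : k' <= bcost b + kcost p + 1 -> Z ^ k' <= Z ^ (bcost b + kcost p + 1).
    by move=> ?; rewrite leq_pexp2l.
  have l1 := le (bcost b) ltac:(lia); have l2 := le (bcost b).+1 ltac:(lia).
  have l3 := le (kcost p).+1 ltac:(lia).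
  rewrite /= [_ + 3](_ : _ = bcost b + kcost p + 1 + 2); last by lia.
  rewrite [Z ^ (_ + 2)]expnD; have : 2 ^ 2 <= Z ^ 2 by rewrite leq_exp2r.
  move=> /(leq_mul (leqnn (Z ^ (bcost b + kcost p + 1)))).
  by apply: leq_trans; lia.
elim: j k m1 => [|j IH] k m1 Nk Ik; case bm: (beval m1 b).
- by have [] := step k m1 Ik bm; lia.
- exists (bcost b).+1, m1; split; [|by lia|by exists k; rewrite bm].
  by apply: ExecWhileStop; rewrite bm.
- have [kN [t1 [m2 [e1 t1Z Ik1]]]] := step k m1 Ik bm.
  have [|t2 [m3 [e2 t2Z Q]]] := IH k.+1 m2 _ Ik1; first by lia.
  exists (bcost b + t1 + t2).+1, m3; split=> //.
    by apply: ExecWhileStep e1 e2; rewrite bm.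
  by lia.
- exists (bcost b).+1, m1; split; [|by lia|by exists k; rewrite bm].
  by apply: ExecWhileStop; rewrite bm.
Qed.

Lemma agree_update X Y m a i j x : a \in X ->
  agree X Y m (Memory (update (ncell m) a i j x) (qcell m)).
Proof.
move=> aX; split=> // b k l bX /=; rewrite /update; case: eqP => //= ba.
by rewrite ba aX in bX.
Qed.

(** * Loops *)

Definition vec a i := NCell a i (NConst 0).
Definition var a := vec a (NConst 0).
Definition setvec a i e := NSet a i (NConst 0) e.
Definition setvar a e := setvec a (NConst 0) e.

Definition BLt e1 e2 := BNot (BLe e2 e1).
Definition BEq e1 e2 := BAnd (BLe e1 e2) (BLe e2 e1).

Lemma beval_lt m e1 e2 : beval m (BLt e1 e2) = (neval m e1 < neval m e2).
Proof. by rewrite /= ltnNge. Qed.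

Definition For v e body :=
  Seq (setvar v (NConst 0))
    (While (BLt (var v) e) (Seq body (setvar v (NAdd (var v) (NConst 1))))).

Definition Count v e p b r :=
  Seq (setvar r (NConst 0))
    (For v e (Seq p (If b (setvar r (NAdd (var r) (NConst 1))) Skip))).

Definition Tabulate v e p a x := For v e (Seq p (setvec a (var v) x)).

(** The bound [e] is evaluated anew at each test, but neither the body nor the counter assigns an
    array that [e] reads. In each round the body may also rely on whatever the earlier rounds cannot
    have changed. *)
Lemma run_for v e body m0 (I : nat -> memory -> Prop) :
  v \notin nmods body -> all (fun a => a \notin v :: nmods body) (nreads e) ->
  neval m0 e <= Z ->
  (forall k m m', agree [:: v] [::] m m' -> I k m -> I k m') ->
  I 0 m0 ->
  (forall k m, k < neval m0 e -> ncell m v 0 0 = k ->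
     agree (v :: nmods body) (qmods body) m0 m -> I k m ->
     run Z body m (I k.+1)) ->
  run Z (For v e body) m0 (I (neval m0 e)).
Proof.
move=> vb eb eZ Iv I0 step; apply: run_seq; apply: run_nset => /=.
set m1 := Memory _ _.
have m01 : agree [:: v] [::] m0 m1 by apply: agree_update; rewrite inE.
pose J k m := [/\ k <= neval m0 e, ncell m v 0 0 = k,
  agree (v :: nmods body) (qmods body) m0 m & I k m].
have eN m : agree (v :: nmods body) (qmods body) m0 m -> neval m e = neval m0 e.
  by move=> /neval_agree; apply.
have J0 : J 0 m1.
  split=> //; [by rewrite /m1 /= /update !eqxx| |exact: Iv m01 I0].
  by apply: agreeW m01 => a; rewrite ?inE // => ->.
apply: run_conseq (run_while eZ J0 _) _ => [k m [kN mv m0m Ik]|m' _ [k [kN [kN' mv m0m Ik]]]].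
  rewrite beval_lt /= mv eN // => kltN; split=> //.
  apply: run_seq; apply: run_conseq (step k m kltN mv m0m Ik) _.
  move=> m2 m_m2 I2; apply: run_nset => /=.
  have m2v : ncell m2 v 0 0 = k by rewrite (proj1 m_m2).
  split=> //=.
  - by rewrite /update !eqxx m2v addn1.
  - apply: agree_trans m0m _.
    apply: agree_trans (agreeW _ _ m_m2) (agree_update _ _ _ _ _ _) => //.
      by move=> a; rewrite !inE => ->; rewrite orbT.
    by rewrite inE eqxx.
  - by apply: Iv I2; apply: agree_update; rewrite inE.
move: kN; rewrite beval_lt /= mv eN // -leqNgt => Nk.
by have -> : neval m0 e = k by apply/eqP; rewrite eqn_leq Nk.
Qed.

Lemma run_count v e p b r m0 (f : nat -> bool) :
  v != r -> v \notin nmods p -> r \notin nmods p ->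
  all (fun a => a \notin [:: v, r & nmods p]) (nreads e) ->
  neval m0 e <= Z ->
  (forall k m, k < neval m0 e -> ncell m v 0 0 = k ->
     agree [:: v, r & nmods p] (qmods p) m0 m ->
     run Z p m (fun m' => beval m' b = f k)) ->
  run Z (Count v e p b r) m0
    (fun m' => ncell m' r 0 0 = \sum_(0 <= k < neval m0 e) f k).
Proof.
move=> vr vp rp ep eZ step; apply: run_seq; apply: run_nset => /=.
set m1 := Memory _ _.
have m01 : agree [:: r] [::] m0 m1 by apply: agree_update; rewrite inE.
have sub : {subset v :: nmods p ++ [:: r] <= [:: v, r & nmods p]}.
  by move=> a; rewrite !inE mem_cat !inE orbCA orbC -!orbA => /or3P[] ->; rewrite ?orbT.
have em1 : neval m1 e = neval m0 e.
  apply: neval_agree m01 _; apply: sub_all ep => a; apply: contra.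
  by rewrite !inE => ->; rewrite orbT.
rewrite -em1.
apply: (@run_for v e _ m1 (fun k m => ncell m r 0 0 = \sum_(0 <= i < k) f i)).
- by rewrite /= mem_cat negb_or vp inE.
- apply: sub_all ep => a; apply: contra; exact: sub.
- by rewrite em1.
- by move=> k m m' [h _] <-; apply: h; rewrite inE eq_sym.
- by rewrite big_geq //= /update !eqxx.
move=> k m; rewrite em1 => kN mv m1m mr; apply: run_seq.
have m0m : agree [:: v, r & nmods p] (qmods p) m0 m.
  apply: agree_trans (agreeW _ _ m01) (agreeW _ _ m1m) => a.
  - by rewrite !inE => ->; rewrite orbT.
  - by [].
  - exact: sub.
  - by rewrite /= cats0.
apply: run_conseq (step k m kN mv m0m) _ => m2 m_m2 bf.
have m2r : ncell m2 r 0 0 = \sum_(0 <= i < k) f i by rewrite (proj1 m_m2).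
apply: run_if; rewrite bf big_nat_recr //=; case: (f k).
  by apply: run_nset; rewrite /= /update !eqxx m2r.
by apply: run_skip; rewrite m2r; lia.
Qed.

(** When entry [k] is computed, the entries from [k] on still have their old values. Thus an array
    can be overwritten in terms of itself, as happens to the labels and to the candidate. *)
Lemma run_tabulate v e p a x m0 (f : nat -> nat) :
  v != a -> v \notin nmods p -> a \notin nmods p ->
  all (fun b => b \notin [:: v, a & nmods p]) (nreads e) ->
  neval m0 e <= Z ->
  (forall k m, k < neval m0 e -> ncell m v 0 0 = k ->
     agree [:: v, a & nmods p] (qmods p) m0 m ->
     (forall j, k <= j -> ncell m a j 0 = ncell m0 a j 0) ->
     run Z p m (fun m' => neval m' x = f k)) ->
  run Z (Tabulate v e p a x) m0
    (fun m' => forall k, k < neval m0 e -> ncell m' a k 0 = f k).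
Proof.
move=> va vp ap ep eZ step.
have sub : {subset v :: nmods p ++ [:: a] <= [:: v, a & nmods p]}.
  by move=> b; rewrite !inE mem_cat !inE orbCA orbC -!orbA => /or3P[] ->; rewrite ?orbT.
pose I k m := (forall j, j < k -> ncell m a j 0 = f j) /\
  forall j, k <= j -> ncell m a j 0 = ncell m0 a j 0.
apply: run_conseq (@run_for v e _ m0 I _ _ eZ _ _ _) _ => [| | |//| |m' _ [] //].
- by rewrite /= mem_cat negb_or vp inE.
- by apply: sub_all ep => b; apply: contra; apply: sub.
- move=> k m m' [h _] [I1 I2]; split=> j jk; rewrite h ?inE 1?eq_sym //; auto.
move=> k m kN mv m0m [I1 I2]; apply: run_seq.
have m0m' : agree [:: v, a & nmods p] (qmods p) m0 m.
  by apply: agreeW m0m => b; [apply: sub|rewrite /= cats0].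
apply: run_conseq (step k m kN mv m0m' I2) _ => m2 m_m2 xf.
have m2v : ncell m2 v 0 0 = k by rewrite (proj1 m_m2).
apply: run_nset; rewrite /= m2v xf; split=> j; rewrite /update /= eqxx /=.
  by rewrite andbT ltnS leq_eqVlt; case: eqP => [->//|_] /= jk; rewrite (proj1 m_m2) ?I1.
by rewrite andbT => kj; rewrite gtn_eqF // (proj1 m_m2) // I2 // ltnW.
Qed.

(** * Binary numbers whose digits sit on the positions of a mask *)

Section Binary.
Variable mask : nat -> bool.

(** Only masked positions carry a digit. The sets inside the mask are therefore numbered without
    gaps, and running through them takes two to the size of the mask rounds, however long the array
    is. *)
Definition place i := 2 ^ \sum_(0 <= j < i) mask j.

Definition value k (Y : nat -> bool) := \sum_(0 <= j < k) Y j * place j.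

Lemma placeS i : place i.+1 = place i * (if mask i then 2 else 1).
Proof. by rewrite /place big_nat_recr //= expnD; case: (mask i). Qed.

Lemma valueS k Y : value k.+1 Y = value k Y + Y k * place k.
Proof. by rewrite /value big_nat_recr. Qed.

Lemma value_lt k (Y : nat -> bool) :
  (forall j, j < k -> Y j -> mask j) -> value k Y < place k.
Proof.
elim: k => [|k IH] sY; first by rewrite /value /place !big_geq.
have := IH (fun j jk => sY j (ltnW jk)); have := sY k (ltnSn k).
by rewrite valueS placeS; case: (Y k) => [->|_] //; case: (mask k); lia.
Qed.

Lemma value_inj k (Y Y' : nat -> bool) :
  (forall j, j < k -> Y j -> mask j) -> (forall j, j < k -> Y' j -> mask j) ->
  value k Y = value k Y' -> forall j, j < k -> Y j = Y' j.
Proof.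
elim: k => // k IH sY sY'; rewrite !valueS => e j.
have sYk i : i < k -> Y i -> mask i by move=> /ltnW; apply: sY.
have sYk' i : i < k -> Y' i -> mask i by move=> /ltnW; apply: sY'.
have := value_lt sYk; have := value_lt sYk' => lt' lt.
have Yk : Y k = Y' k by case: (Y k) e; case: (Y' k) => //; lia.
rewrite ltnS leq_eqVlt => /orP[/eqP->//|]; apply: IH => //.
by move: e; rewrite Yk; lia.
Qed.

End Binary.

(** * Enumeration of the subsets of a mask by a binary counter *)

Definition Increment x mask c i e :=
  Seq (setvar c (NConst 1))
    (For i e (If (BAnd (BLe (NConst 1) (vec mask (var i))) (BLe (NConst 1) (var c)))
       (If (BLe (NConst 1) (vec x (var i)))
          (setvec x (var i) (NConst 0))
          (Seq (setvec x (var i) (NConst 1)) (setvar c (NConst 0))))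
       Skip)).

Definition Enumerate x mask c i e body :=
  Seq (Tabulate i e Skip x (NConst 0))
    (Seq (setvar c (NConst 0))
       (While (BLe (var c) (NConst 0)) (Seq body (Increment x mask c i e)))).

Definition bits N (m : memory) x (Y : nat -> bool) :=
  forall j, j < N -> ncell m x j 0 = Y j.

Section Enumerate.

Variables (x mask c i : nat) (e : nexpr) (mk : nat -> bool).
Hypothesis ids : uniq [:: x; mask; c; i].
Hypothesis e_ids : all (fun a => a \notin [:: x; c; i]) (nreads e).

Let bits_sub N (Y : nat -> bool) := forall j, j < N -> Y j -> mk j.

(** Ripple carry: the bits below the current position, together with the carry, represent the old
    value plus one, and the bits from there on are unchanged. A final carry occurs only if [X] was
    the full mask. *)
Lemma run_increment m0 X :
  let N := neval m0 e in
  N <= Z -> (forall j, j < N -> (0 < ncell m0 mask j 0) = mk j) ->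
  bits N m0 x X -> bits_sub N X ->
  run Z (Increment x mask c i e) m0 (fun m' => exists Y (b : bool),
    [/\ bits N m' x Y, bits_sub N Y, ncell m' c 0 0 = b &
        value mk N Y + b * place mk N = (value mk N X).+1]).
Proof.
move=> N NZ mkE Xm sX; apply: run_seq; apply: run_nset => /=.
move: ids; rewrite /= !inE !negb_or.
move=> /andP[/and3P[xM xc xi] /andP[/andP[Mc Mi] /andP[ci _]]].
set m1 := Memory _ _.
have m01 : agree [:: c] [::] m0 m1 by apply: agree_update; rewrite inE.
have em1 : neval m1 e = N.
  apply: neval_agree m01 _; apply: sub_all e_ids => a; apply: contra.
  by rewrite !inE => ->; rewrite orbT.
pose I k m := exists Y (b : bool), [/\ bits N m x Y, bits_sub N Y,
  ncell m c 0 0 = b, forall j, k <= j -> Y j = X j &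
  value mk k Y + b * place mk k = (value mk k X).+1].
rewrite -em1.
apply: run_conseq (@run_for i e _ m1 I _ _ _ _ _ _) _ => [| | | | | |m' _ [Y [b [? ? ? _ ?]]]].
- by rewrite /= !inE ![i == _]eq_sym !negb_or !xi ci.
- apply: sub_all e_ids => a; apply: contra; rewrite !inE.
  by case/or4P=> ->; rewrite ?orbT.
- by rewrite em1.
- move=> k m m' [h _] [Y [b [Ym sY mc YX Yv]]]; exists Y, b; split=> //.
    by move=> j jN; rewrite h ?inE //; apply: Ym.
  by rewrite h ?inE.
- exists X, true; split=> //.
  + by move=> j jN; rewrite (proj1 m01) ?inE //; apply: Xm.
  + by rewrite /m1 /= /update !eqxx.
  + by rewrite /value /place !big_geq.
- move=> k m; rewrite em1 => kN mi m1m [Y [b [Ym sY mc YX Yv]]].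
  have Mk : 0 < ncell m mask k 0 = mk k.
    rewrite (proj1 m1m) ?(proj1 m01) ?mkE // !inE ?negb_or ?Mi ?Mc //=.
    by rewrite eq_sym xM.
  have Yk : Y k = X k by apply: YX.
  (* The four cases below (position outside the mask, no carry, digit one, digit zero) only have to
     supply the new digit and carry. *)
  have next (b' : bool) m2 (Y' : nat -> bool) : (forall j, j < N -> j != k -> ncell m2 x j 0 = ncell m x j 0) ->
      ncell m2 x k 0 = Y' k -> (forall j, j != k -> Y' j = Y j) -> (Y' k -> mk k) ->
      ncell m2 c 0 0 = b' ->
      (Y' k) * place mk k + b' * place mk k.+1 = X k * place mk k + b * place mk k ->
      I k.+1 m2.
    move=> m2x m2k Y'j Y'k m2c Y'v; exists Y', b'; split=> //.
    + move=> j jN; case: (eqVneq j k) => [->//|jk].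
      by rewrite m2x // Y'j //; apply: Ym.
    + by move=> j jN; case: (eqVneq j k) => [->//|jk]; rewrite Y'j //; apply: sY.
    + by move=> j kj; rewrite Y'j ?gtn_eqF // YX // ltnW.
    + rewrite !valueS; suff -> : value mk k Y' = value mk k Y by move: Y'v Yv; clear; lia.
      by apply: eq_big_nat => j jk; rewrite Y'j // ltn_eqF //; case/andP: jk.
  apply: run_if; rewrite /= mi Mk mc.
  case mkk: (mk k) => /=; last first.
    apply: run_skip; apply: (next b m Y) => //; first by rewrite Ym.
      by move/(sY _ kN); rewrite mkk.
    by rewrite Yk placeS mkk muln1.
  case: b mc Yv next => mc Yv next /=; last first.
    by apply: run_skip; apply: (next false m Y) => //; rewrite ?Ym ?mkk // Yk.
  apply: run_if; rewrite /= mi Ym // Yk; case Xk: (X k) => /=.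
    apply: run_nset; apply: (next true _ (fun j => (j != k) && Y j)).
    + by move=> j jN jk /=; rewrite /update mi (negbTE jk) andbF.
    + by rewrite /= /update mi !eqxx.
    + by move=> j ->.
    + by [].
    + by rewrite /= /update [c == x]eq_sym (negbTE xc).
    + by rewrite eqxx Xk placeS mkk; lia.
  apply: run_seq; apply: run_nset; apply: run_nset.
  apply: (next false _ (fun j => (j == k) || Y j)).
  + move=> j jN jk /=; rewrite /update mi (negbTE jk) andbF.
    by rewrite (negbTE xc).
  + by rewrite /= /update mi !eqxx (negbTE xc).
  + by move=> j /negbTE->.
  + by [].
  + by rewrite /= /update !eqxx.
  + by rewrite eqxx Xk; lia.
by exists Y, b; rewrite -?em1; split=> //; rewrite em1.
Qed.

(** [Good Y] records that the set [Y] has been dealt with: the body establishes it while [Y] is in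
    [x], and later rounds preserve it. Since [value] is injective on sets inside the mask, counting
    through all values reaches every such set. *)
Lemma run_enumerate body m0 (I : memory -> Prop)
    (Good : (nat -> bool) -> memory -> Prop) :
  let N := neval m0 e in
  x \notin nmods body -> mask \notin nmods body ->
  all (fun a => a \notin nmods body) (nreads e) ->
  N <= Z -> place mk N <= Z ->
  (forall j, j < N -> (0 < ncell m0 mask j 0) = mk j) ->
  (forall m m', agree [:: x; c; i] [::] m m' -> I m -> I m') ->
  (forall Y m m', agree [:: x; c; i] [::] m m' -> Good Y m -> Good Y m') ->
  I m0 ->
  (forall m, agree ([:: x; c; i] ++ nmods body) (qmods body) m0 m -> I m ->
     (forall j, j < N -> 0 < ncell m x j 0 -> mk j) ->
     run Z body m (fun m' => [/\ I m', forall Y, bits N m x Y -> Good Y m' &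
       forall Y, Good Y m -> Good Y m'])) ->
  run Z (Enumerate x mask c i e body) m0
    (fun m' => I m' /\ forall Y, bits_sub N Y -> Good Y m').
Proof.
move=> N xb Mb eb NZ pZ mkE Iv Gv I0 step.
move: (ids); rewrite /= !inE !negb_or.
move=> /andP[/and3P[xM xc xi] /andP[/andP[Mc Mi] /andP[ci _]]].
pose X0 := [:: x; c; i] ++ nmods body.
have eN m : agree X0 (qmods body) m0 m -> neval m e = N.
  move=> h; apply: neval_agree h _; apply/allP => a ae.
  rewrite mem_cat negb_or; move/allP: eb => -> //.
  by move/allP: e_ids => ->.
have mkN m : agree X0 (qmods body) m0 m ->
    forall j, j < N -> (0 < ncell m mask j 0) = mk j.
  move=> [h _] j jN; rewrite h ?mkE // mem_cat negb_or Mb !inE !negb_or.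
  by rewrite eq_sym xM Mc Mi.
apply: run_seq; apply: run_conseq (@run_tabulate i e Skip x (NConst 0) m0 (fun=> 0)
   _ _ _ _ _ _) _ => [||| | | |m1 m01 m1x] //.
- by rewrite eq_sym.
- by apply: sub_all e_ids => a; rewrite !inE !negb_or => /and3P[-> _ ->].
- by move=> k m *; apply: run_skip.
apply: run_seq; apply: run_nset; set m2 := Memory _ _.
have m12 : agree [:: c] [::] m1 m2 by apply: agree_update; rewrite inE.
have m02' : agree [:: x; c; i] [::] m0 m2.
  apply: agree_trans (agreeW _ _ m01) (agreeW _ _ m12) => a //=;
  by rewrite !inE; do ?[case/orP]; move=> ->; rewrite ?orbT.
have m02 : agree X0 (qmods body) m0 m2.
  by apply: agreeW m02' => a // ax; rewrite mem_cat ax.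
(* The carry is also the stop flag. While it is zero, [x] holds the set of value [k] and the sets of
   smaller value are done; once it is one, all sets are done. *)
pose J k m := [/\ agree X0 (qmods body) m0 m, I m & exists b : bool,
  ncell m c 0 0 = b /\ if b then forall Y, bits_sub N Y -> Good Y m else
    (exists X, [/\ bits N m x X, bits_sub N X & value mk N X = k]) /\
    forall Y, bits_sub N Y -> value mk N Y < k -> Good Y m].
apply: run_conseq (run_while pZ (_ : J 0 m2) _) _ => [|k m|m _ [k [mc []]]].
- split=> //; first exact: Iv m02' I0.
  exists false; split; first by rewrite /m2 /= /update !eqxx.
  split=> //; exists (fun=> false); split=> //.
    by move=> j jN; rewrite (proj1 m12) ?inE // m1x.
  by rewrite /value big1.
- move=> [m0m Im [b [/= mc]]]; rewrite -/(var c) mc; case: b mc => //= mc.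
  move=> [[X [Xm sX Xk]] Gm] _; split; first by rewrite -Xk; apply: value_lt.
  apply: run_seq; apply: run_conseq (step m m0m Im _) _.
    by move=> j jN; rewrite Xm //; case Xj: (X j) => // _; apply: sX.
  move=> m3 m_m3 [I3 G3 Gm3].
  have m03 : agree X0 (qmods body) m0 m3.
    apply: agree_trans m0m (agreeW _ _ m_m3) => a //.
    by rewrite mem_cat => ->; rewrite orbT.
  have e3 := eN _ m03; have X3 : bits N m3 x X.
    by move=> j jN; rewrite (proj1 m_m3) //; apply: Xm.
  apply: run_conseq (@run_increment m3 X _ _ _ _) _; rewrite ?e3 //; first exact: mkN.
  move=> m4 m34 [Y [b [Ym sY m4c Yv]]].
  have m34' : agree [:: x; c; i] [::] m3 m4.
    by apply: agreeW m34 => a //=; rewrite !inE;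
      do ?[case/orP]; move=> ->; rewrite ?orbT.
  split; [|exact: Iv m34' I3|].
    apply: agree_trans m03 (agreeW _ _ m34') => a // ax.
    by rewrite mem_cat ax.
  have G4 Y' : bits_sub N Y' -> value mk N Y' <= k -> Good Y' m4.
    move=> sY'; rewrite leq_eqVlt => /orP[/eqP Y'k|Y'k].
      apply: Gv m34' _; apply: G3 => j jN; rewrite Xm //.
      by rewrite (@value_inj mk N Y' X sY' sX _ j jN) // Y'k.
    by apply: Gv m34' _; apply/Gm3/Gm.
  exists b; split=> //; case: b m4c Yv => m4c Yv.
    move=> Y' sY'; apply: G4 => //; have := value_lt sY'; lia.
  split; last by move=> Y' sY'; rewrite ltnS; apply: G4.
  by exists Y; split=> //; lia.
- by move=> _ Im [[] [mc' H]]; [split|move: mc; rewrite /= mc'].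
Qed.

End Enumerate.

(** * The algorithm *)

(* Natural arrays, in addition to the input 0 (n), 1 (adjacency), 2 (pairs) and
   the output 3:
   4, 5: s and s ^ 2; 6: labels of the vertices; 7: number of the contraction;
   8, 9, 24: vertices; 10, 11: counters; 12: temporary; 13: label of the merged
   vertices; 14, 15: labels in use, and a set S of them; 16: vertices allowed
   by S; 17: candidate; 18: vertex whose block is searched; 19, 20, 21: allowed
   vertices in the block, a set of them, and the best such set so far;
   22, 23: carry and position of the binary counter.
   Rational arrays, in addition to the weights 0: 1: weight of a set;
   2: weight of 21; 3: weight of 3. *)

Definition qvar q := QCell q (NConst 0) (NConst 0).
Definition setqvar q e := QSet q (NConst 0) (NConst 0) e.
Definition positive e := BLe (NConst 1) e.

(** * Independence test, weight, and update of the best set so far *)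

Definition Clash src :=
  Count 8 (var 0)
    (Count 9 (var 0) Skip
       (BAnd (positive (vec src (var 8)))
          (BAnd (positive (vec src (var 9))) (positive (NCell 1 (var 8) (var 9))))) 10)
    (positive (var 10)) 11.

Definition Weigh src :=
  Seq (setqvar 1 (QConst 0%R))
    (For 8 (var 0) (If (positive (vec src (var 8)))
       (setqvar 1 (QAdd (qvar 1) (QCell 0 (var 8) (NConst 0)))) Skip)).

Definition Copy src dst := Tabulate 8 (var 0) Skip dst (vec src (var 8)).

Definition Improve src dst q :=
  Seq (Clash src) (Seq (Weigh src)
    (If (BAnd (BLe (var 11) (NConst 0)) (BNot (BQLe (qvar 1) (qvar q))))
       (Seq (setqvar q (qvar 1)) (Copy src dst)) Skip)).

Definition content n (m : memory) a : {set 'I_n} := [set v : 'I_n | 0 < ncell m a v 0].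
Arguments content : clear implicits.

Lemma sum_bool_gt0 n (f : nat -> bool) :
  (0 < \sum_(0 <= k < n) f k) = [exists k : 'I_n, f k].
Proof.
rewrite big_mkord lt0n sum_nat_eq0 negb_forall; apply: eq_existsb => k.
by rewrite eqb0 negbK.
Qed.

Section Fragments.
Variables (n : nat) (G : graph n) (w : 'I_n -> rat).

Definition loaded m := [/\ ncell m 0 0 0 = n,
  forall u v, ncell m 1 u v = graph_rel G u v &
  forall v : 'I_n, qcell m 0 v 0 = w v].

Lemma loaded_agree X Y m m' : agree X Y m m' ->
  0 \notin X -> 1 \notin X -> 0 \notin Y -> loaded m -> loaded m'.
Proof.
move=> [nm qm] x0 x1 y0 [mn mG mw]; split=> [|u v|v]; first by rewrite nm.
  by rewrite nm.
by rewrite qm.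
Qed.

Lemma content_agree X Y m m' a : agree X Y m m' -> a \notin X ->
  content n m' a = content n m a.
Proof. by move=> [h _] aX; apply/setP=> v; rewrite !inE h. Qed.

Hypothesis nZ : n <= Z.

Lemma run_clash src m0 : loaded m0 -> src \notin [:: 8; 9; 10; 11] ->
  run Z (Clash src) m0
    (fun m => (ncell m 11 0 0 == 0) = independent G (content n m0 src)).
Proof.
move=> [mn mG _]; rewrite !inE !negb_or => /and4P[s8 s9 s10 s11].
pose g k j := [&& 0 < ncell m0 src k 0, 0 < ncell m0 src j 0 & graph_rel G k j].
apply: run_conseq (@run_count _ _ _ _ _ _
  (fun k => 0 < \sum_(0 <= j < n) g k j) _ _ _ _ _ _) _ => //=.
- by rewrite mn.
- move=> k m1 kn m1k m01.
  have m1n : ncell m1 0 0 0 = n by rewrite (proj1 m01).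
  apply: run_conseq (@run_count _ _ _ _ _ _ (g k) _ _ _ _ _ _) _ => //=.
  + by rewrite m1n.
  + move=> j m2 jn m2j m12; apply: run_skip.
    have m2k : ncell m2 8 0 0 = k by rewrite (proj1 m12).
    rewrite /= m2j m2k !(proj1 m12) ?(proj1 m01) // ?inE ?negb_or ?s8 ?s9 ?s10 ?s11 //.
    by rewrite mG lt0b.
  + by move=> m2 _ ->; rewrite m1n.
move=> m _ ->; rewrite mn eqn0Ngt sum_bool_gt0 negb_exists /independent.
apply: eq_forallb => u; rewrite sum_bool_gt0 negb_exists inE /g.
case: (0 < ncell m0 src u 0) => /=; last by apply/forallP.
by apply: eq_forallb => v; rewrite inE graph_relE implybE negb_and.
Qed.

Lemma run_weigh src m0 : loaded m0 -> src != 8 ->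
  run Z (Weigh src) m0 (fun m => qcell m 1 0 0 = weight w (content n m0 src)).
Proof.
move=> [mn _ mw] s8; apply: run_seq; apply: run_qset; set m1 := Memory _ _.
pose I k m := qcell m 1 0 0 =
  (\sum_(0 <= j < k) if (0 < ncell m0 src j 0)%N then qcell m0 0 j 0 else 0)%R.
apply: run_conseq (@run_for _ _ _ _ I _ _ _ _ _ _) _ => //=.
- by rewrite mn.
- by move=> k m m' [_ h]; rewrite /I h.
- by rewrite /I big_geq //= /update /=.
- rewrite mn => k m kn mk m1m Ik; apply: run_if; rewrite /= mk.
  have -> : ncell m src k 0 = ncell m0 src k 0 by rewrite (proj1 m1m) // inE.
  have mk0 : qcell m 0 k 0 = qcell m0 0 k 0 by rewrite (proj2 m1m).
  case: ifP => sk; [apply: run_qset|apply: run_skip];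
    rewrite /I big_nat_recr //= sk ?GRing.addr0 //.
  by rewrite /update /= mk mk0 Ik.
move=> m _; rewrite /I mn big_mkord => ->; rewrite /weight [RHS]big_mkcond.
by apply: eq_bigr => v _; rewrite inE mw.
Qed.

Lemma run_copy src dst m0 : loaded m0 -> uniq [:: src; dst; 0; 8] ->
  run Z (Copy src dst) m0 (fun m => content n m dst = content n m0 src).
Proof.
move=> [mn _ _]; rewrite /= !inE !negb_or.
move=> /andP[/and3P[sd s0 s8] /andP[/andP[d0 d8] _]].
apply: run_conseq (@run_tabulate _ _ _ _ _ _ (fun k => ncell m0 src k 0) _ _ _ _ _ _) _
  => //=.
- by rewrite eq_sym.
- by rewrite !inE andbT [0 == dst]eq_sym.
- by rewrite mn.
- move=> k m kn mk m0m _; apply: run_skip.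
  by rewrite /= mk (proj1 m0m) // !inE negb_or s8.
by move=> m _ h; apply/setP=> v; rewrite !inE h // mn.
Qed.

Lemma run_improve src dst q m0 : loaded m0 ->
  uniq [:: src; dst; 0; 1; 8; 9; 10; 11] -> q \notin [:: 0; 1] ->
  let X := content n m0 src in
  run Z (Improve src dst q) m0 (fun m =>
    if independent G X && (qcell m0 q 0 0 < weight w X)%R
    then content n m dst = X /\ qcell m q 0 0 = weight w X
    else content n m dst = content n m0 dst /\ qcell m q 0 0 = qcell m0 q 0 0).
Proof.
move=> m0l; rewrite /= !inE !negb_or -!andbA => ids /andP[q0 q1].
case/and5P: ids => sd s0 s1 s8 /and5P[s9 s10 s11 d0] /and5P[d1 d8 d9 d10 /andP[d11 _]].
apply: run_seq; apply: run_conseq (run_clash m0l _) _.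
  by rewrite !inE !negb_or s8 s9 s10 s11.
move=> m1 m01 m1i; have m1l : loaded m1 by apply: loaded_agree m01 _ _ _ m0l.
apply: run_seq; apply: run_conseq (run_weigh m1l s8) _ => m2 m12.
rewrite (content_agree m01) ?inE ?negb_or ?s8 ?s9 ?s10 ?s11 // => m2w.
have m2l : loaded m2 by apply: loaded_agree m12 _ _ _ m1l.
have m2q : qcell m2 q 0 0 = qcell m0 q 0 0.
  by rewrite (proj2 m12) ?(proj2 m01) // !inE negb_or q1.
apply: run_if; rewrite /= m2w m2q (proj1 m12) // leqn0 m1i -ltNge.
have m2s : content n m2 src = content n m0 src.
  rewrite (content_agree m12) ?(content_agree m01) // !inE !negb_or ?s8 ?s9 ?s10 ?s11 //.
have m2d : content n m2 dst = content n m0 dst.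
  rewrite (content_agree m12) ?(content_agree m01) // !inE !negb_or ?d8 ?d9 ?d10 ?d11 //.
case: ifP => _; last by apply: run_skip.
apply: run_seq; apply: run_qset; set m3 := Memory _ _.
have m23 : agree [::] [:: q] m2 m3.
  by split=> // b j k; rewrite inE /= /update => /negbTE->.
have m3l : loaded m3 by apply: loaded_agree m23 _ _ _ m2l; rewrite // inE eq_sym.
apply: run_conseq (run_copy m3l _) _.
  by rewrite /= !inE !negb_or sd s0 s8 d0 d8.
move=> m4 m34 ->; rewrite (content_agree m23) // m2s (proj2 m34) //=.
by rewrite /update !eqxx m2w.
Qed.

End Fragments.

(** * Exhaustive search inside blocks and over sets of blocks *)

Definition Choose b e1 e2 := If b (setvar 12 e1) (setvar 12 e2).

(** For the vertex in 8, cell 10 counts its non-neighbours in the block of the vertex in 9, and cell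
    11 counts the vertices whose block rules it out. *)
Definition Allowed :=
  Tabulate 8 (var 0)
    (Seq
      (Count 9 (var 0)
        (Count 24 (var 0) Skip
          (BAnd (BEq (vec 6 (var 24)) (vec 6 (var 9)))
             (BLe (NCell 1 (var 8) (var 24)) (NConst 0))) 10)
        (BAnd (positive (vec 15 (vec 6 (var 9))))
           (BAnd (BNot (BEq (vec 6 (var 9)) (vec 6 (var 8)))) (BLe (var 10) (NConst 0)))) 11)
      (Choose (BAnd (positive (vec 15 (vec 6 (var 8)))) (BLe (var 11) (NConst 0)))
         (NConst 1) (NConst 0)))
    16 (var 12).

Definition SameBlock := BEq (vec 6 (var 8)) (vec 6 (var 18)).

Definition BestInBlock :=
  Seq (Tabulate 8 (var 0)
         (Choose (BAnd SameBlock (positive (vec 16 (var 8)))) (NConst 1) (NConst 0))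
         19 (var 12))
  (Seq (Tabulate 8 (var 0) Skip 21 (NConst 0))
  (Seq (setqvar 2 (QConst 0%R))
  (Seq (Enumerate 20 19 22 23 (var 0) (Improve 20 21 2))
       (Tabulate 8 (var 0) (Choose SameBlock (vec 21 (var 8)) (vec 17 (var 8)))
          17 (var 12))))).

(** All labels are below [4n], so a set of blocks is an array of that length, masked by the labels
    in use. *)
Definition Search :=
  Enumerate 15 14 22 23
    (NAdd (NAdd (var 0) (var 0)) (NAdd (var 0) (var 0)))
    (Seq Allowed (Seq (For 18 (var 0) BestInBlock) (Improve 17 3 3))).

Section Search.
Variables (n : nat) (G : graph n) (w : 'I_n -> rat) (l : 'I_n -> nat).
Hypothesis nZ : n <= Z.

Hypothesis blockZ : forall f, 2 ^ #|block l f| <= Z.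

Definition labelled m := forall v : 'I_n, ncell m 6 v 0 = l v.

Lemma run_choose b e1 e2 m (Q : memory -> Prop) :
  (forall m', agree [:: 12] [::] m m' ->
     ncell m' 12 0 0 = (if beval m b then neval m e1 else neval m e2) -> Q m') ->
  run Z (Choose b e1 e2) m Q.
Proof.
move=> H; apply: run_if; case: (beval m b) H => H; apply: run_nset; apply: H;
by [apply: agree_update; rewrite inE|rewrite /= /update].
Qed.

(** The second conclusion protects the blocks treated before. A block is searched again for each of
    its vertices, with the same guarantee every time. *)
Lemma run_best (v0 : 'I_n) m0 : loaded G w m0 -> labelled m0 -> ncell m0 18 0 0 = v0 ->
  let K := block l (l v0) in
  run Z BestInBlock m0 (fun m =>
    heaviest G w (content n m0 16 :&: K) (content n m 17 :&: K) /\
    content n m 17 :\: K = content n m0 17 :\: K).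
Proof.
move=> m0l m0lab m0v K; apply: run_seq.
have [m0n _ _] := m0l.
pose A := content n m0 16 :&: K.
apply: run_conseq (@run_tabulate _ _ _ _ _ _
  (fun k => (ncell m0 6 k 0 == l v0) && (0 < ncell m0 16 k 0) : nat) _ _ _ _ _ _) _ => //=.
- by rewrite m0n.
- move=> k m kn mk m0m _; apply: run_choose => m' _ ->.
  rewrite /= mk !(proj1 m0m 6) ?(proj1 m0m 18) ?(proj1 m0m 16) //= m0v m0lab -eqn_leq.
  by case: (_ && _).
move=> m1 m01 m1A; apply: run_seq.
rewrite m0n in m1A.
have m1l : loaded G w m1 by apply: loaded_agree m01 _ _ _ m0l.
have [m1n _ _] := m1l.
apply: run_conseq (@run_tabulate _ _ _ _ _ _ (fun=> 0) _ _ _ _ _ _) _ => //=.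
- by rewrite m1n.
- by move=> *; apply: run_skip.
move=> m2 m12; rewrite m1n => m2z; apply: run_seq; apply: run_qset; set m3 := Memory _ _.
have m23 : agree [::] [:: 2] m2 m3.
  by split=> // b j k; rewrite inE /= /update => /negbTE->.
have m13 := agree_cat m12 m23; have m03 := agree_cat m01 m13.
have m3l : loaded G w m3 by apply: loaded_agree m13 _ _ _ m1l.
pose mk k := (k < n) && (0 < ncell m0 16 k 0) && (ncell m0 6 k 0 == l v0).
pose I m := [/\ content n m 21 \subset A, independent G (content n m 21) &
  weight w (content n m 21) = qcell m 2 0 0].
pose Good (Y : nat -> bool) m := independent G [set v : 'I_n | Y v] ->
  (weight w [set v : 'I_n | Y v] <= qcell m 2 0 0)%R.
have m3b0 : content n m3 21 = set0.
  by apply/setP=> v; rewrite !inE (proj1 m23) // m2z ?ltn_ord.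
apply: run_seq.
apply: run_conseq (@run_enumerate 20 19 22 23 (var 0) mk _ _
  (Improve 20 21 2) m3 I Good _ _ _ _ _ _ _ _ _ _) _ => //.
- by rewrite /= (proj1 m13) // m1n.
(* The masked positions are vertices of the block, whose size thus bounds the exponent. *)
- apply: leq_trans (blockZ (l v0)); rewrite /= (proj1 m13) // m1n.
  rewrite leq_exp2l // big_mkord -sum1_card [leqRHS]big_mkcond /=.
  apply: leq_sum => v _; rewrite inE /mk (m0lab v) andbC.
  by case: (l v == l v0) => //=; case: (_ && _).
- move=> j; rewrite /= (proj1 m13) // m1n => jn.
  by rewrite (proj1 m13) // m1A // lt0b /mk jn andbC.
- by move=> m m' mm'; rewrite /I (content_agree _ mm') // (proj2 mm').
- by move=> Y m m' mm'; rewrite /Good (proj2 mm').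
- by rewrite /I m3b0 sub0set independent_set0 weight_set0.
- move=> m m3m [I1 I2 I3] mkm.
  have ml : loaded G w m by apply: loaded_agree m3m _ _ _ m3l.
  apply: run_conseq (run_improve nZ ml _ _) _ => // m' _.
  set X := content n m 20; move: mkm; rewrite /= (proj1 m13) // m1n => mkm.
  have XA : X \subset A.
    apply/subsetP=> v; rewrite !inE => /mkm; rewrite /mk ltn_ord => /(_ isT).
    by rewrite m0lab.
  have XE Y : bits n m 20 Y -> [set v : 'I_n | Y v] = X.
    by move=> Ym; apply/setP=> v; rewrite !inE Ym // lt0b.
  case: ifP => [/andP[iX ltX]|geX] [m'X m'q].
    split; first by rewrite /I m'X m'q.
      by move=> Y /XE YX; rewrite /Good YX m'q.
    by move=> Y GY iY; rewrite m'q (le_trans (GY iY)) // ltW.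
  split; first by rewrite /I m'X m'q.
    by move=> Y /XE YX; rewrite /Good YX m'q => iX; move: geX; rewrite iX /= leNgt => ->.
  by move=> Y GY iY; rewrite m'q GY.
move=> m4 m34 [[I1 I2 I3] G4].
have m04 := agree_cat m03 m34.
have best4 : heaviest G w A (content n m4 21).
  split=> // D DA iD; rewrite I3.
  pose Y k := if insub k is Some v then v \in D else false.
  have YD : [set v : 'I_n | Y v] = D by apply/setP=> v; rewrite inE /Y valK.
  rewrite -YD; apply: G4; last by rewrite YD.
  move=> k _; rewrite /Y /mk; case: insubP => // v -> <- /(subsetP DA).
  by rewrite !inE m0lab.
have m4l : loaded G w m4 by apply: loaded_agree m04 _ _ _ m0l.
have [m4n _ _] := m4l.
apply: run_conseq (@run_tabulate _ _ _ _ _ _ (fun k =>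
  if ncell m4 6 k 0 == l v0 then ncell m4 21 k 0 else ncell m4 17 k 0) _ _ _ _ _ _) _
  => //=.
- by rewrite m4n.
- move=> k m kn mk' m4m m17; apply: run_choose => m' _ ->.
  rewrite /= mk' !(proj1 m4m 6) ?(proj1 m4m 18) ?(proj1 m4m 21) //= m17 //.
  by rewrite (proj1 m04 18) // m0v (proj1 m04 6 v0) // m0lab -eqn_leq.
move=> m5 m45; rewrite m4n => m5c.
have m4lab v : ncell m4 6 v 0 = ncell m0 6 v 0 by rewrite (proj1 m04).
have -> : content n m5 17 :&: K = content n m4 21.
  apply/setP=> v; rewrite !inE m5c // m4lab m0lab.
  case: eqP => [_|/eqP lv]; first by rewrite andbT.
  rewrite andbF; apply/esym/negbTE; apply/negP => v4.
  have := subsetP I1 v; rewrite !inE v4 => /(_ isT).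
  by rewrite (negbTE lv) andbF.
split=> //; apply/setP=> v; rewrite !inE m5c // m4lab m0lab.
by case: eqP => //= _; rewrite (proj1 m04).
Qed.

Lemma run_allowed m0 : loaded G w m0 -> labelled m0 ->
  run Z Allowed m0 (fun m =>
    content n m 16 = allowed G l (fun x => 0 < ncell m0 15 x 0)).
Proof.
move=> m0l m0lab; have [m0n m0G _] := m0l.
pose S x := 0 < ncell m0 15 x 0; pose L := fun k => ncell m0 6 k 0.
pose h v u k := (L k == L u) && ~~ graph_rel G v k.
pose g v u := [&& S (L u), L u != L v & ~~ (0 < \sum_(0 <= k < n) h v u k)].
pose f v := S (L v) && ~~ (0 < \sum_(0 <= u < n) g v u).
apply: run_conseq (@run_tabulate _ _ _ _ _ _ (fun k => f k : nat) _ _ _ _ _ _) _ => //=.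
- by rewrite m0n.
- move=> v m vn mv m0m _; apply: run_seq.
  have mn : ncell m 0 0 0 = n by rewrite (proj1 m0m).
  apply: run_conseq (@run_count _ _ _ _ _ _ (g v) _ _ _ _ _ _) _ => //=.
  + by rewrite mn.
  + move=> u m1 un m1u mm1; have m01 := agree_cat m0m mm1.
    have m1n : ncell m1 0 0 0 = n by rewrite (proj1 m01).
    have m1v : ncell m1 8 0 0 = v by rewrite (proj1 mm1).
    apply: run_conseq (@run_count _ _ _ _ _ _ (h v u) _ _ _ _ _ _) _ => //=.
    * by rewrite m1n.
    * move=> k m2 kn m2k m12; have m02 := agree_cat m01 m12; apply: run_skip.
      rewrite /= m2k (proj1 m12 8) // m1v (proj1 m12 9) // m1u.
      by rewrite !(proj1 m02 6) ?(proj1 m02 1) //= m0G -eqn_leq leqn0 eqb0 /h /L.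
    move=> m2 m12 m2s; have m02 := agree_cat m01 m12.
    rewrite (proj1 m12 8) // m1v (proj1 m12 9) // m1u m2s m1n.
    by rewrite !(proj1 m02 6) ?(proj1 m02 15) //= -eqn_leq leqn0 eqn0Ngt /g /S /L.
  move=> m1 mm1 m1s; apply: run_choose => m' _ ->; have m01 := agree_cat m0m mm1.
  rewrite /= (proj1 mm1 8) // mv m1s mn !(proj1 m01 6) ?(proj1 m01 15) //= leqn0 eqn0Ngt.
  by rewrite -/(S _) -/(f v); case: (f v).
move=> m _; rewrite m0n => mf; apply/setP=> v; rewrite !inE mf // lt0b /f /L m0lab.
congr (_ && _); rewrite sum_bool_gt0 negb_exists; apply: eq_forallb => u.
rewrite /g /L !m0lab -/(S (l u)); case: (S (l u)) => //=; case: (l u != l v) => //=.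
rewrite negbK sum_bool_gt0; apply: eq_existsb => k.
by rewrite /h /L !m0lab graph_relE.
Qed.

(** For an arbitrary [S] the blockwise set may fail to be independent. [Improve] therefore tests it,
    and the comparison of weights is conditional on independence. *)
Lemma run_search m0 : loaded G w m0 -> labelled m0 ->
  (forall v, l v < n + n + (n + n)) -> n + n + (n + n) <= Z ->
  (forall x, x < n + n + (n + n) -> (0 < ncell m0 14 x 0) = [exists v, l v == x]) ->
  2 ^ (\sum_(0 <= x < n + n + (n + n)) [exists v, l v == x]) <= Z ->
  (forall v : 'I_n, ncell m0 3 v 0 = 0) -> qcell m0 3 0 0 = 0%R ->
  run Z Search m0 (fun m => independent G (content n m 3) /\
    forall S : nat -> bool, (forall x, S x -> [exists v, l v == x]) ->
    exists C, blockwise G w l S C /\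
      (independent G C -> (weight w C <= weight w (content n m 3))%R)).
Proof.
move=> m0l m0lab ln nnZ m0mask maskZ m0o m0q; have [m0n m0G _] := m0l.
pose I m := independent G (content n m 3) /\ weight w (content n m 3) = qcell m 3 0 0.
pose Good S m := exists C, blockwise G w l S C /\
  (independent G C -> (weight w C <= qcell m 3 0 0)%R).
apply: run_conseq (@run_enumerate 15 14 22 23 _ (fun x => [exists v, l v == x])
  _ _ _ m0 I Good _ _ _ _ _ _ _ _ _ _) _ => //=; rewrite ?m0n //.
- by move=> m m' mm'; rewrite /I (content_agree _ mm') // (proj2 mm').
- by move=> S m m' mm'; rewrite /Good (proj2 mm').
- have o0 : content n m0 3 = set0 by apply/setP=> v; rewrite !inE m0o.
  by rewrite /I o0 independent_set0 weight_set0 m0q.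
- move=> m m0m [I1 I2] _; have ml : loaded G w m by apply: loaded_agree m0m _ _ _ m0l.
  have mlab : labelled m by move=> v; rewrite (proj1 m0m).
  apply: run_seq; apply: run_conseq (run_allowed ml mlab) _ => m1 mm1 m1A.
  have m01 := agree_cat m0m mm1.
  have m1l : loaded G w m1 by apply: loaded_agree m01 _ _ _ m0l.
  set A := allowed _ _ _ in m1A; have [m1n _ _] := m1l.
  pose J k m := forall v : 'I_n, v < k ->
    heaviest G w (A :&: block l (l v)) (content n m 17 :&: block l (l v)).
  apply: run_seq; apply: run_conseq (@run_for _ _ _ _ J _ _ _ _ _ _) _ => //=.
  + by rewrite m1n.
  + by move=> k m2 m3 h J2 v vk; rewrite (content_agree _ h) //; apply: J2.
  + rewrite m1n => k m2 kn m2k m12 J2; have m02 := agree_cat m01 m12.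
    have m2l : loaded G w m2 by apply: loaded_agree m02 _ _ _ m0l.
    have m2lab : labelled m2 by move=> v; rewrite (proj1 m02).
    apply: run_conseq (@run_best (Ordinal kn) m2 m2l m2lab m2k) _ => m3 m23.
    rewrite (content_agree _ m12) // m1A => -[H3 E3] v; rewrite ltnS leq_eqVlt.
    case: (eqVneq (l v) (l (Ordinal kn))) => [->|lv]; first by [].
    case/orP => [/eqP vk|vk]; first by rewrite (_ : v = Ordinal kn) ?eqxx // in lv; apply: val_inj.
    suff -> : content n m3 17 :&: block l (l v) = content n m2 17 :&: block l (l v).
      exact: J2.
    (* The block of [v] is disjoint from the one just searched, so the candidate has not changed on
       it. *)
    have bD : block l (l v) = block l (l v) :\: block l (l (Ordinal kn)).
      by apply/setP=> u; rewrite !inE andbC; case: eqP => //= ->; rewrite lv.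
    by rewrite bD !setIDA ![_ :&: block l (l v)]setIC -!setIDA E3.
  move=> m2 m12 J2; have m02 := agree_cat m01 m12.
  have m2l : loaded G w m2 by apply: loaded_agree m02 _ _ _ m0l.
  have bw : blockwise G w l (fun x => 0 < ncell m 15 x 0) (content n m2 17).
    by move=> v; apply: J2; rewrite m1n.
  have m2o : content n m2 3 = content n m 3.
    by rewrite (content_agree _ m12) // (content_agree _ mm1).
  have m2q : qcell m2 3 0 0 = qcell m 3 0 0 by rewrite (proj2 m12) ?(proj2 mm1).
  have Gm S : bits (n + n + (n + n)) m 15 S -> blockwise G w l S (content n m2 17).
    move=> Sm v; rewrite (@eq_allowed _ G l S (fun x => 0 < ncell m 15 x 0)) // => u.
    by rewrite Sm ?lt0b.
  apply: run_conseq (run_improve nZ m2l _ _) _ => // m3 m23.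
  rewrite m2q m2o; case: ifP => [/andP[iC ltC]|leC] [m3o m3q].
    split; first by rewrite /I m3o m3q.
      by move=> S /Gm bS; exists (content n m2 17); split=> // _; rewrite m3q.
    move=> S [C [bC leC]]; exists C; split=> // /leC H; rewrite m3q.
    by rewrite (le_trans H) // ltW.
  split; first by rewrite /I m3o m3q.
    move=> S /Gm bS; exists (content n m2 17); split=> // iC; rewrite m3q.
    by move: leC; rewrite iC /= leNgt => ->.
  by move=> S [C [bC leC']]; exists C; rewrite m3q.
move=> m m0m [[I1 I2] Gm]; split=> // S SL.
have [|C [bC leC]] := Gm S; first by move=> j _; apply: SL.
by exists C; rewrite I2.
Qed.

End Search.

(** * Computation of the block size, the labels and the labels in use *)

Definition SqrtUp :=
  While (BLt (var 5) (var 0))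
    (Seq (setvar 5 (NAdd (NAdd (var 5) (var 4)) (NAdd (var 4) (NConst 1))))
         (setvar 4 (NAdd (var 4) (NConst 1)))).

Definition Merged :=
  let twice := NAdd (var 0) (var 0) in
  BNot (BAnd
    (BNot (BEq (vec 6 (var 8)) (NAdd (NCell 2 (var 7) (NConst 0)) twice)))
    (BNot (BEq (vec 6 (var 8)) (NAdd (NCell 2 (var 7) (NConst 1)) twice)))).

Definition Relabel :=
  Seq (Count 8 (var 0) Skip Merged 10)
  (Seq (setvar 13 (NAdd (var 0) (var 7)))
  (Seq (If (BLe (var 4) (var 10)) Skip
          (setvar 13 (NAdd (var 13) (NAdd (var 0) (var 0)))))
       (Tabulate 8 (var 0) (Choose Merged (var 13) (vec 6 (var 8))) 6 (var 12)))).

Definition Contract :=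
  Seq (Tabulate 8 (var 0) Skip 6 (NAdd (var 8) (NAdd (var 0) (var 0))))
      (For 7 (NSub (var 0) (NConst 1)) Relabel).

Definition Mark :=
  Tabulate 8 (NAdd (NAdd (var 0) (var 0)) (NAdd (var 0) (var 0)))
    (Count 9 (var 0) Skip (BEq (vec 6 (var 9)) (var 8)) 10) 14 (var 10).

Definition Algorithm := Seq SqrtUp (Seq Contract (Seq Mark Search)).

Lemma square_ge n : exists s, n <= s * s.
Proof. by exists n; case: n => // n; rewrite leq_pmulr. Qed.

Definition sqrt_up n := ex_minn (square_ge n).

Lemma sqrt_up_square n : n <= sqrt_up n * sqrt_up n.
Proof. by rewrite /sqrt_up; case: ex_minnP. Qed.

Lemma sqrt_up_min n k : n <= k * k -> sqrt_up n <= k.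
Proof. by rewrite /sqrt_up; case: ex_minnP => r _ rP /rP. Qed.

Section Phases.
Variables (n : nat) (G : graph n) (w : 'I_n -> rat) (cs : seq (nat * nat)).
Hypothesis nZ : n + n + (n + n) <= Z.

Let n_leZ : n <= Z.
Proof. by lia. Qed.

(** The machine does not multiply, so cell 5 follows the square of cell 4 by
    [(k + 1) ^ 2 = k ^ 2 + k + (k + 1)]. *)
Lemma run_sqrt_up m0 : loaded G w m0 -> ncell m0 4 0 0 = 0 -> ncell m0 5 0 0 = 0 ->
  run Z SqrtUp m0 (fun m => ncell m 4 0 0 = sqrt_up n).
Proof.
move=> [m0n _ _] m0s m0q.
pose I k m := [/\ ncell m 0 0 0 = n, ncell m 4 0 0 = k, ncell m 5 0 0 = k * k &
  k <= sqrt_up n].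
have rn : sqrt_up n <= Z.
  by apply: leq_trans n_leZ; apply: sqrt_up_min; case: (n) => // k; rewrite leq_pmulr.
apply: run_conseq (run_while rn (_ : I 0 m0) _) _ => // [k m|m _ [k [kn [mn ms mq kr]]]].
  case=> mn ms mq kr; rewrite beval_lt /= mn mq => kn.
  have ltk : k < sqrt_up n.
    by rewrite ltnNge; apply/negP => rk; move: (leq_mul rk rk) (sqrt_up_square n) kn; lia.
  split=> //; apply: run_seq; apply: run_nset; apply: run_nset.
  by split; rewrite //= /update //= ms ?mq; lia.
rewrite ms; apply/eqP; rewrite eqn_leq kr sqrt_up_min //.
by move: kn; rewrite beval_lt /= mn mq -leqNgt.
Qed.

Let lab : nat -> 'I_n -> nat := labels (sqrt_up n) cs.

Definition paired m := forall i,
  ncell m 2 i 0 = (nth (0, 0) cs i).1 /\ ncell m 2 i 1 = (nth (0, 0) cs i).2.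

Lemma run_contract m0 : loaded G w m0 -> paired m0 -> ncell m0 4 0 0 = sqrt_up n ->
  run Z Contract m0 (labelled (lab n.-1)).
Proof.
move=> m0l m0p m0s; have [m0n _ _] := m0l; apply: run_seq.
apply: run_conseq (@run_tabulate _ _ _ _ _ _ (fun k => k + (n + n)) _ _ _ _ _ _) _ => //=.
- by rewrite m0n.
- by move=> k m _ mk m0m _; apply: run_skip; rewrite /= mk (proj1 m0m) ?m0n.
move=> m1 m01; rewrite m0n => m1lab.
have m1n : ncell m1 0 0 0 = n by rewrite (proj1 m01).
pose I k := labelled (lab k).
apply: run_conseq (@run_for _ _ _ _ I _ _ _ _ _ _) _ => //=; last first.
- by move=> m _; rewrite m1n subn1.
- rewrite m1n => k m kn mk m1m Ik; have m0m := agree_cat m01 m1m.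
  have mn : ncell m 0 0 0 = n by rewrite (proj1 m0m).
  have ms : ncell m 4 0 0 = sqrt_up n by rewrite (proj1 m0m).
  pose p := nth (0, 0) cs k.
  pose hit j := (ncell m 6 j 0 == p.1 + (n + n)) || (ncell m 6 j 0 == p.2 + (n + n)).
  (* The test serves both to count the merged vertices and to relabel them; in the second use array
     6 is being overwritten, but its entry [j] is still the old one. *)
  have hitE X Y m' j : agree X Y m m' -> 0 \notin X -> 2 \notin X -> 7 \notin X ->
      ncell m' 6 j 0 = ncell m 6 j 0 -> ncell m' 8 0 0 = j ->
      beval m' Merged = hit j.
    move=> mm' x0 x2 x7 m'j m'8; have [p1 p2] := m0p k.
    rewrite /Merged /= -!eqn_leq m'8 m'j !(proj1 mm' 7) // !(proj1 mm' 0) //.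
    by rewrite !(proj1 mm' 2) // mk !(proj1 m0m 2) // mn p1 p2 negb_and !negbK.
  apply: run_seq; apply: run_conseq (@run_count _ _ _ _ _ _ hit _ _ _ _ _ _) _ => //=.
  + by rewrite mn.
  + move=> j m2 jn m2j mm2; apply: run_skip; apply: (hitE _ _ _ _ mm2) => //.
    by rewrite (proj1 mm2).
  move=> m2 mm2; rewrite mn => m2c; apply: run_seq; apply: run_nset.
  rewrite /= (proj1 mm2) // mn (proj1 mm2) // mk; set m3 := Memory _ _.
  have m23 : agree [:: 13] [::] m2 m3 by apply: agree_update; rewrite inE.
  have mergedE : merged p (lab k) = [set v : 'I_n | hit v].
    by apply/setP=> v; rewrite !inE /hit Ik.
  have cE : \sum_(0 <= j < n) hit j = #|merged p (lab k)|.
    rewrite mergedE -sum1_card [RHS]big_mkcond big_mkord.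
    by apply: eq_bigr => v _; rewrite inE; case: (hit v).
  have mm3 := agree_cat mm2 m23.
  apply: run_seq; apply: (@run_conseq _ _ (fun m => agree [:: 13] [::] m3 m /\
      ncell m 13 0 0 = merged_label (sqrt_up n) p (n + k) (lab k))).
    have m3s : ncell m3 4 0 0 = sqrt_up n by rewrite (proj1 mm3).
    have m3c : ncell m3 10 0 0 = #|merged p (lab k)| by rewrite (proj1 m23) // m2c.
    apply: run_if; rewrite [beval _ _](_ : _ = (sqrt_up n <= #|merged p (lab k)|)); last first.
      by rewrite -m3s -m3c.
    rewrite /merged_label; case: ifP => _.
      by apply: run_skip; split=> //; rewrite /m3 /= /update eqxx.
    apply: run_nset; split; first by apply: agree_update; rewrite inE.
    by rewrite /= /update /= (proj1 mm2) // mn.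
  move=> m4 _ [m34 m4t]; have mm4 := agree_cat mm3 m34.
  have m4n : ncell m4 0 0 0 = n by rewrite (proj1 mm4).
  apply: run_conseq (@run_tabulate _ _ _ _ _ _ (fun j =>
    if hit j then ncell m4 13 0 0 else ncell m 6 j 0) _ _ _ _ _ _) _ => //=.
  + by rewrite m4n.
  + move=> j m5 jn m5j m45 m56; apply: run_choose => m6 _ ->.
    have m5lab : ncell m5 6 j 0 = ncell m 6 j 0 by rewrite m56 ?(proj1 mm4).
    rewrite (hitE _ _ _ j (agree_cat mm4 m45)) //= m5j m5lab.
    by rewrite (proj1 m45).
  move=> m7 _; rewrite m4n => m7lab v; rewrite m7lab // m4t Ik.
  have -> : lab k.+1 = relabel (sqrt_up n) p (n + k) (lab k) by [].
  by rewrite /relabel mergedE inE.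
- by move=> v; rewrite m1lab.
- by move=> k m m' mm' Ik v; rewrite (proj1 mm').
- by rewrite m1n; lia.
Qed.

Lemma run_mark (l : 'I_n -> nat) m0 : loaded G w m0 -> labelled l m0 ->
  run Z Mark m0 (fun m => forall x, x < n + n + (n + n) ->
    (0 < ncell m 14 x 0) = [exists v, l v == x]).
Proof.
move=> [m0n _ _] m0lab; pose g x k := ncell m0 6 k 0 == x.
apply: run_conseq (@run_tabulate _ _ _ _ _ _ (fun x => \sum_(0 <= k < n) g x k)
  _ _ _ _ _ _) _ => //=.
- by rewrite m0n.
- move=> x m xn mx m0m _.
  have mn : ncell m 0 0 0 = n by rewrite (proj1 m0m).
  apply: run_conseq (@run_count _ _ _ _ _ _ (g x) _ _ _ _ _ _) _ => //=.
  + by rewrite mn.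
  + move=> k m1 kn m1k mm1; apply: run_skip; have m01 := agree_cat m0m mm1.
    by rewrite /= m1k (proj1 m01 6) // (proj1 mm1 8) // mx -eqn_leq.
  by rewrite mn.
move=> m _; rewrite m0n => mm x xn; rewrite mm // sum_bool_gt0.
by apply: eq_existsb => v; rewrite /g m0lab.
Qed.

End Phases.
End Run.

(** * Correctness and cost of the whole algorithm *)

Lemma opt_ge0 n (G : graph n) (w : 'I_n -> rat) : (0 <= opt G w)%R.
Proof.
rewrite /opt; case: Order.TotalTheory.arg_maxP => [|I _ /(_ set0)].
  exact: independent_set0.
by rewrite weight_set0; apply; apply: independent_set0.
Qed.

(** With [s = sqrt_up n], the [4n] labels, the at most [2 ^ (2s)] subsets of a block and the at most
    [2 ^ (s + 1)] sets of blocks are all bounded by [Z = 2 ^ (4s)]. *)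
Lemma run_algorithm d n (G : graph n) (w : 'I_n -> rat) (cs : seq (nat * nat)) :
  d_sequence d G cs ->
  run (2 ^ (4 * sqrt_up n)) Algorithm (input G w cs) (fun m =>
    independent G (content n m 3) /\
    (opt G w <= d.+1%:R * weight w (content n m 3))%R).
Proof.
move=> dcs; set s := sqrt_up n; set Z := 2 ^ _.
have nE := size_d_sequence dcs; have ns : n <= s * s := sqrt_up_square n.
have s_gt0 : 0 < s by rewrite lt0n; apply: contraTneq ns => ->; rewrite nE.
have Z_gt1 : 1 < Z by rewrite /Z -{1}(expn0 2) ltn_exp2l // muln_gt0.
have nZ : n + n + (n + n) <= Z.
  have s2 : s < 2 ^ s := ltn_expl _ (ltnSn 1).
  have two : 2 <= 2 ^ s by rewrite -{1}(expn1 2) leq_exp2l.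
  rewrite /Z -{1}[4]/(2 + 2) mulnDl expnD !mul2n -!addnn !expnD.
  (* Each of the four factors is at most [2 ^ s]. *)
  apply: (@leq_trans (s * s * (2 * 2))); first by lia.
  by rewrite !leq_mul // ltnW.
have nZ' : n <= Z by lia.
set m0 := input G w cs.
have m0l : loaded G w m0 by split=> // v; rewrite /= valK.
have m0p : paired cs m0 by [].
apply: run_seq => //; apply: run_conseq (run_sqrt_up Z_gt1 nZ m0l _ _) _ => // m1 m01 m1s.
have m1l : loaded G w m1 by apply: loaded_agree m01 _ _ _ m0l.
have m1p : paired cs m1 by move=> i; rewrite !(proj1 m01).
apply: run_seq => //; apply: run_conseq (run_contract Z_gt1 nZ m1l m1p m1s) _ => m2 m12 m2lab.
have m02 := agree_cat m01 m12.
have m2l : loaded G w m2 by apply: loaded_agree m02 _ _ _ m0l.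
apply: run_seq => //; apply: run_conseq (run_mark Z_gt1 nZ m2l m2lab) _ => m3 m23 m3k.
have m03 := agree_cat m02 m23.
have m3l : loaded G w m3 by apply: loaded_agree m03 _ _ _ m0l.
have m3lab : labelled (labels s cs n.-1 : 'I_n -> nat) m3.
  by move=> v; rewrite (proj1 m23) ?m2lab.
have n1 : n.-1 = size cs by rewrite nE.
have [lM lsmall llt lcount] := tracks_final s_gt0 dcs ns.
rewrite n1 in m3lab m3k.
have le4 k : k <= 4 * s -> 2 ^ k <= Z by move=> ?; rewrite leq_exp2l.
apply: run_conseq (run_search Z_gt1 nZ' _ m3l m3lab llt nZ m3k _ _ _) _.
- by move=> f; apply: le4; apply: leq_trans (lsmall f) _; lia.
- by apply: le4; apply: leq_trans lcount _; lia.
- by move=> v; rewrite (proj1 m03).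
- by rewrite (proj2 m03).
move=> m _ [iO best]; split=> //.
have /boolp.choice [M MP] : forall f, exists M, size M <= d /\
    forall v, f < labels s cs (size cs) v -> labels s cs (size cs) v \notin M ->
      homogeneous G v (block (labels s cs (size cs)) f).
  by move=> f; have [M sM MP] := lM f; exists M.
have [S [Sl SP]] := blockwise_opt w (fun f => (MP f).1) (fun f => (MP f).2).
have [C [bC CO]] := best S Sl; have [iC oC] := SP C bC.
by apply: le_trans oC _; rewrite ler_wpM2l ?ler0n // CO.
Qed.

(** * Real estimates for the running time and the ratio *)

Local Open Scope ring_scope.

Section Real.
Variable R : realType.

(** If [sqrt_up n] is [k + 1], minimality gives [k * k < n], so [k + 1] is at most the square root
    plus one, and the square root is at least one. *)
Lemma sqrt_up_le n : (0 < n)%N -> (sqrt_up n)%:R <= 2 * Num.sqrt n%:R :> R.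
Proof.
move=> n_gt0.
have sqrt1 : 1 <= Num.sqrt n%:R :> R by rewrite -{1}sqrtr1 ler_sqrt ?ler1n ?ltr0n.
case s: (sqrt_up n) => [|k]; first by rewrite mulr_ge0 ?sqrtr_ge0.
have kn : (k * k < n)%N.
  by rewrite ltnNge; apply/negP => /sqrt_up_min; rewrite s ltnn.
have : k%:R <= Num.sqrt n%:R :> R.
  rewrite -[leLHS]ger0_norm ?ler0n // -sqrtr_sqr ler_sqrt ?ltr0n //.
  by rewrite -natrX ler_nat expnS expn1 ltnW.
by rewrite -natr1; lra.
Qed.

(** Crude bounds suffice: [c_] is at least [8 / 3] times [d + 1] and the power of two is at least
    [16], so a third of [d_] already exceeds [d + 1]. *)
Lemma approx_ratio_ge d : d.+1%:R <= approx_ratio R d.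
Proof.
rewrite /approx_ratio; apply: le_trans (ceil_ge _).
have c_ge : 8 / 3 * d.+1%:R <= c_ R d.
  rewrite /c_ natr1 -[leRHS]mulrA ler_wpM2l ?divr_ge0 ?ler0n //.
  have d1 : 1 <= d.+1%:R :> R by rewrite ler1n.
  rewrite expr2 -mulrA ler_peMr ?ler0n // mulr_ege1 ?exprn_ege1 ?ler1n //.
have p16 : 16 <= powR 2 (4 * c_ R d + 4) :> R.
  have -> : 16 = powR 2 4%:R :> R by rewrite powR_mulrn ?ler0n // -natrX.
  rewrite ler_powR ?ler1n // lerDr mulr_ge0 //.
  by apply: le_trans c_ge; rewrite mulr_ge0 ?divr_ge0.
have d0 : 0 <= d.+1%:R :> R by rewrite ler0n.
have : 8 / 3 * d.+1%:R * 16 <= d_ R d.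
  by apply: ler_pM c_ge p16; lra.
by lra.
Qed.

End Real.

Theorem theorem3p3 (R : realType) (d' : nat) :
  exists (p : program) (C : R),
    forall (n : nat) (G : graph n) (w : 'I_n -> rat) (s : seq (nat * nat)),
      d_sequence d' G s ->
      exists (t : nat) (m : memory),
        [/\ exec p (input G w s) t m,
            t%:R <= powR 2 (C * Num.sqrt n%:R) :> R,
            independent G (output n m) &
            ratr (weight w (output n m)) >= ratr (opt G w) / approx_ratio R d'].
Proof.
(* The cost is at most [2 ^ (4 * sqrt_up n * K)], and [sqrt_up n] is at most twice the square root
   of [n]; hence the factor [8]. *)
pose K := kcost Algorithm; exists Algorithm, (8 * K%:R) => n G w s ds.
have [t [m [tm tZ [iO oO]]]] := run_algorithm w ds.
have outE : output n m = content n m 3.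
  by apply/setP=> v; rewrite !inE lt0n.
exists t, m; rewrite outE; split=> //.
  have n_gt0 : (0 < n)%N by rewrite (size_d_sequence ds).
  have -> : 8 * K%:R * Num.sqrt n%:R = 4 * K%:R * (2 * Num.sqrt n%:R) :> R by ring.
  apply: (@le_trans _ _ (powR 2 (4 * sqrt_up n * K)%:R)).
    by rewrite powR_mulrn ?ler0n // -natrX ler_nat expnM.
  rewrite ler_powR ?ler1n // !natrM mulrAC ler_wpM2l ?mulr_ge0 ?ler0n //.
  exact: sqrt_up_le.
have ratio_gt0 : 0 < approx_ratio R d' by apply: lt_le_trans (approx_ratio_ge R d').
rewrite ler_pdivrMr //.
(* Nonnegativity allows the factor [d' + 1] to be replaced by the larger [approx_ratio R d']. *)
have W0 : 0 <= weight w (content n m 3).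
  by rewrite -(@pmulr_rge0 _ d'.+1%:R) ?ltr0n // (le_trans _ oO) ?opt_ge0.
apply: (@le_trans _ _ (ratr (d'.+1%:R * weight w (content n m 3)))).
  by rewrite ler_rat.
by rewrite rmorphM /= ratr_nat mulrC ler_wpM2l ?ler0q ?approx_ratio_ge.
Qed.
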